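(* Let $X$ be a subdomain of the unit disk $\Delta$. Then $X$ is a $\rho$-Bloch subdomain of $\Delta$ if, and only if, $X$ is degenerate in $\Delta$.
   Context: $\Delta=\{z\in\mathbb{C}:|z|<1\}$. A subdomain of $\Delta$ is a nonempty connected open subset of $\Delta$ (possibly $\Delta$ itself). $\rho$ denotes the Poincaré (hyperbolic) metric on $\Delta$ with density $\rho(z)=\frac{1}{1-|z|^2}$, and $\rho(\cdot,\cdot)$ also denotes the associated distance. $\rho$-Bloch: for a subdomain $X$ of $\Delta$, let $R(X,\Delta)$ be the supremum of all radii (measured with respect to $\rho$) of hyperbolic disks $\{z\in\Delta:\rho(z,p)<r\}$ that are contained in $X$. $X$ is a $\rho$-Bloch subdomain of $\Delta$ if $R(X,\Delta)<\infty$. Degenerate: given a sequence $f_1,f_2,f_3,\ldots$ of holomorphic maps $f_n:\Delta\to X$, the iterated function system generated by it is the sequence $F_n=f_1\circ f_2\circ\cdots\circ f_n:\Delta\to X\subset\Delta$. An accumulation point of $(F_n)$ is a holomorphic function $F$ on $\Delta$ that is the limit, uniformly on compact subsets of $\Delta$, of some subsequence of $(F_n)$. $X$ is degenerate in $\Delta$ if every iterated function system generated by a sequence of holomorphic maps from $\Delta$ to $X$ has only constant accumulation points. *)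

(* Defs.v *)
From Stdlib Require Import Reals List.
From Coquelicot Require Import Coquelicot.
Open Scope R_scope.

(* Coquelicot's [is_connected] and Stdlib's [compact] only concern subsets of
   [R]; these are the usual notions in an arbitrary uniform space. *)
Definition connected_set {T : UniformSpace} (X : T -> Prop) : Prop :=
  forall U V : T -> Prop,
    open U -> open V ->
    (forall x, X x -> U x \/ V x) ->
    (exists x, X x /\ U x) -> (exists x, X x /\ V x) ->
    exists x, X x /\ U x /\ V x.

Definition compact_set {T : UniformSpace} (K : T -> Prop) : Prop :=
  forall (I : Type) (U : I -> T -> Prop),
    (forall i, open (U i)) ->
    (forall x, K x -> exists i, U i x) ->
    exists l : list I, forall x, K x -> exists i, In i l /\ U i x.

Definition unit_disk (z : C) : Prop := Cmod z < 1.

Definition subdomain (X D : C -> Prop) : Prop :=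
  (forall z, X z -> D z) /\
  (exists z, X z) /\ open X /\ connected_set X.

Definition poincare_density (z : C) : R := / (1 - Cmod z ^ 2).

(* [g] is parametrized by [0, 1].  The derivative at the endpoints is two-sided
   and [g], [dg] are irrelevant outside [0, 1]: this is no restriction, since a
   C^1 path on [0, 1] extends to a C^1 path on the real line. *)
Definition C1_path_in_disk (g dg : R -> C) : Prop :=
  forall t, 0 <= t <= 1 ->
    unit_disk (g t) /\
    @is_derive R_AbsRing C_R_NormedModule g t (dg t) /\
    @continuous R_UniformSpace C_UniformSpace dg t.

Definition C1_path_length (g dg : R -> C) : R :=
  RInt (fun t => poincare_density (g t) * Cmod (dg t)) 0 1.

(* [path_length z w l]: some piecewise C^1 path in the disk from [z] to [w],
   i.e. a finite concatenation of C^1 paths, has Poincare length [l]. *)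
Inductive path_length : C -> C -> R -> Prop :=
| path_length_C1 (g dg : R -> C) :
    C1_path_in_disk g dg ->
    path_length (g 0) (g 1) (C1_path_length g dg)
| path_length_concat (z w u : C) (l1 l2 : R) :
    path_length z w l1 -> path_length w u l2 -> path_length z u (l1 + l2).

(* Meaningful for [z] and [w] in the disk, where the set of lengths is nonempty
   and bounded below by 0, so that its infimum is finite. *)
Definition poincare_dist (z w : C) : R := real (Glb_Rbar (path_length z w)).

Definition hyperbolic_disk (p : C) (r : R) (z : C) : Prop :=
  unit_disk z /\ poincare_dist z p < r.

Definition bloch_radius (X : C -> Prop) : Rbar :=
  Lub_Rbar (fun r : R =>
    0 < r /\
    exists p : C, unit_disk p /\ forall z, hyperbolic_disk p r z -> X z).

Definition rho_Bloch (X : C -> Prop) : Prop := Rbar_lt (bloch_radius X) p_infty.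

Definition holomorphic_on (D : C -> Prop) (f : C -> C) : Prop :=
  forall z, D z -> @ex_derive C_AbsRing C_NormedModule f z.

Definition holomorphic_map (D X : C -> Prop) (f : C -> C) : Prop :=
  holomorphic_on D f /\ forall z, D z -> X (f z).

(* Indices start at 0: [ifs f n] is [f 0 \o f 1 \o ... \o f n]. *)
Fixpoint ifs (f : nat -> C -> C) (n : nat) : C -> C :=
  match n with
  | O => f O
  | S m => fun z => ifs f m (f (S m) z)
  end.

Definition accumulation_point (G : nat -> C -> C) (F : C -> C) : Prop :=
  holomorphic_on unit_disk F /\
  exists phi : nat -> nat,
    (forall n, (phi n < phi (S n))%nat) /\
    forall K : C -> Prop,
      compact_set K -> (forall z, K z -> unit_disk z) ->
      forall eps : R, 0 < eps ->
      exists N : nat, forall n, (N <= n)%nat ->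
      forall z, K z -> Cmod (G (phi n) z - F z)%C < eps.

Definition degenerate (X : C -> Prop) : Prop :=
  forall f : nat -> C -> C,
    (forall n, holomorphic_map unit_disk X (f n)) ->
    forall F : C -> C,
      accumulation_point (ifs f) F ->
      exists c : C, forall z, unit_disk z -> F z = c.

(* Main.v *)
Require Import Defs.
From Stdlib Require Import Reals List.
From Coquelicot Require Import Coquelicot.
From Stdlib Require Import Lia Lra Psatz ClassicalEpsilon.

(** The pseudo-hyperbolic distance of [z] and [w] is [Cmod (mobius w z)], where
    [mobius w z = (w - z) / (1 - conj w * z)] is the involution of the disk that
    exchanges [w] and 0.  Everything is done with this distance; the Poincare
    distance enters only through two comparisons: a short path keeps its ends
    at a pseudo-hyperbolic distance bounded away from 1
    ([mobius_le_of_hyperbolic_disk]) and conversely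
    ([hyperbolic_disk_of_mobius]).  So the Bloch condition reads: for some
    [t < 1], no pseudo-hyperbolic disk of radius [t] lies in [X].

    Bloch implies degenerate.  A holomorphic map [f] from the disk to [X] then
    omits, near every point of its image, a value at distance at most [t].  By
    the Schwarz lemma with its stability ([omitted_value_contraction]), [f]
    contracts distances up to a given [x0 < 1] by a factor [k < 1] that does not
    depend on [f].  Hence [F_n] contracts by [k ^ (n + 1)], and every limit is
    constant.

    Degenerate implies Bloch.  The whole disk is not degenerate, because of the
    identity map, so [X] misses a point [w0].  If [X] is not Bloch, it contains
    disks of centers [p_n] and radii [1 - e_n] with [e_n] as small as desired,
    and [p_n] is forced towards the unit circle, since [w0] is not in these
    disks.  With [t_n = 1 - e_n] and [u] the unit constant
    [conj p_(n+1) / |p_(n+1)|], put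
      [m_n z = t_n * u * z * mobius p_(n+1) z]   and   [f_n = mobius p_n o m_n].
    The map [f_n] takes its values in the [n]-th disk.  As [m_n] is invariant
    under the involution [mobius p_(n+1)], the compositions telescope:
      [f_0 o ... o f_n = mobius p_0 o m_0 o ... o m_n].
    As [p_(n+1)] is close to the circle, [m_n] is close to the identity on
    compact sets, and [m_0 o ... o m_n] converges to a map that fixes 0 and
    almost fixes 1/2: a nonconstant accumulation point.

    The complex analysis rests on one tool, the maximum principle
    ([max_principle]), for functions that are continuous and differentiable off
    isolated points; allowing such points makes it apply directly to difference
    quotients, which yields the Schwarz-Pick lemma and the theorem of
    Weierstrass on uniform limits.  It comes from the mean value property, which
    is the theorem of Goursat for a rectangle in the coordinates
    [z = z0 + exp (s + i * theta)]. *)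

(** * The complex modulus *)

Lemma Cmod_sub_sym (a b : C) : Cmod (a - b)%C = Cmod (b - a)%C.
Proof. rewrite <- Cmod_opp. f_equal. ring. Qed.

Lemma Cmod_sub_triangle (a b c : C) :
  Cmod (a - c)%C <= Cmod (a - b)%C + Cmod (b - c)%C.
Proof.
  replace (a - c)%C with ((a - b) + (b - c))%C by ring. apply Cmod_triangle.
Qed.

Lemma Cmod_le_add_sub (a b : C) : Cmod a <= Cmod b + Cmod (a - b)%C.
Proof.
  replace a with (b + (a - b))%C at 1 by ring. apply Cmod_triangle.
Qed.

Lemma Cmod_sub_le (a b : C) : Cmod (a - b)%C <= Cmod a + Cmod b.
Proof.
  rewrite <- (Cmod_opp b). apply Cmod_triangle.
Qed.

Lemma Cmod_sq (z : C) : Cmod z ^ 2 = fst z ^ 2 + snd z ^ 2.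
Proof. exact (Cmod2_alt z). Qed.

Lemma Cmod_pos_neq (z : C) : z <> 0%C -> 0 < Cmod z.
Proof. apply Cmod_gt_0. Qed.

Lemma RtoC_inj_neq (x : R) : x <> 0 -> RtoC x <> 0%C.
Proof. intros H E. apply H. exact (f_equal fst E). Qed.

Lemma Cmod_sub_pos (z w : C) : w <> z -> 0 < Cmod (w - z)%C.
Proof.
  intros H. apply Cmod_gt_0. intros E. apply H.
  replace w with ((w - z) + z)%C by ring. rewrite E. ring.
Qed.

Lemma Cminus_neq_0 (z w : C) : w <> z -> (w - z)%C <> 0%C.
Proof. intros H. apply Cmod_gt_0, Cmod_sub_pos, H. Qed.

Lemma Cmult_cancel_r (a b c : C) : c <> 0%C -> (a * c)%C = (b * c)%C -> a = b.
Proof.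
  intros Hc E. replace a with (a * c / c)%C by (field; exact Hc).
  rewrite E. field. exact Hc.
Qed.

Lemma sq_le_sq (x y : R) : 0 <= y -> x ^ 2 <= y ^ 2 -> x <= y.
Proof. intros. nra. Qed.

(** * Continuity and complex differentiability *)

Definition ccont (f : C -> C) (z : C) : Prop :=
  forall eps, 0 < eps -> exists d, 0 < d /\
    forall w, Cmod (w - z)%C < d -> Cmod (f w - f z)%C < eps.

(** Differentiability in the form of Caratheodory: the difference quotient of [f]
    at [z] extends to a function [q] continuous at [z], the derivative being
    [q z].  The calculus rules become algebraic identities, and [q] is itself
    the function needed for the Schwarz lemma. *)
Definition slope_at (f q : C -> C) (z : C) : Prop :=
  ccont q z /\ forall w, f w = (f z + q w * (w - z))%C.

Definition cdiff (f : C -> C) (z : C) : Prop := exists q, slope_at f q z.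

Lemma ccont_const (c z : C) : ccont (fun _ => c) z.
Proof.
  intros e He. exists 1. split; [lra|]. intros w _.
  replace (c - c)%C with (RtoC 0) by ring. rewrite Cmod_0; lra.
Qed.

Lemma ccont_id (z : C) : ccont (fun w => w) z.
Proof. intros e He. exists e. auto. Qed.

Lemma ccont_plus (f g : C -> C) (z : C) :
  ccont f z -> ccont g z -> ccont (fun w => f w + g w)%C z.
Proof.
  intros Hf Hg e He.
  destruct (Hf (e/2)) as [d1 [D1 H1]]; [lra|].
  destruct (Hg (e/2)) as [d2 [D2 H2]]; [lra|].
  exists (Rmin d1 d2). split; [now apply Rmin_pos|]. intros w Hw.
  specialize (H1 w (Rlt_le_trans _ _ _ Hw (Rmin_l _ _))).
  specialize (H2 w (Rlt_le_trans _ _ _ Hw (Rmin_r _ _))).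
  replace (f w + g w - (f z + g z))%C with ((f w - f z) + (g w - g z))%C by ring.
  eapply Rle_lt_trans; [apply Cmod_triangle|]. lra.
Qed.

Lemma ccont_mult (f g : C -> C) (z : C) :
  ccont f z -> ccont g z -> ccont (fun w => f w * g w)%C z.
Proof.
  intros Hf Hg e He.
  pose (A := Cmod (f z) + 1). pose (B := Cmod (g z) + 1).
  assert (0 < A) by (unfold A; generalize (Cmod_ge_0 (f z)); lra).
  assert (0 < B) by (unfold B; generalize (Cmod_ge_0 (g z)); lra).
  destruct (Hf (Rmin 1 (e/2/B))) as [d1 [D1 H1]].
  { apply Rmin_pos; [lra|]. repeat apply Rdiv_lt_0_compat; lra. }
  destruct (Hg (e/2/A)) as [d2 [D2 H2]].
  { repeat apply Rdiv_lt_0_compat; lra. }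
  exists (Rmin d1 d2). split; [now apply Rmin_pos|]. intros w Hw.
  specialize (H1 w (Rlt_le_trans _ _ _ Hw (Rmin_l _ _))).
  specialize (H2 w (Rlt_le_trans _ _ _ Hw (Rmin_r _ _))).
  assert (H3 := Rlt_le_trans _ _ _ H1 (Rmin_l _ _)).
  assert (H4 := Rlt_le_trans _ _ _ H1 (Rmin_r _ _)).
  replace (f w * g w - f z * g z)%C
    with (f w * (g w - g z) + (f w - f z) * g z)%C by ring.
  eapply Rle_lt_trans; [apply Cmod_triangle|]. rewrite !Cmod_mult.
  assert (Cmod (f w) <= A) by (unfold A; generalize (Cmod_le_add_sub (f w) (f z)); lra).
  assert (E1 : Cmod (f w) * Cmod (g w - g z)%C <= A * (e/2/A)).
  { apply Rmult_le_compat; try apply Cmod_ge_0; lra. }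
  assert (E2 : Cmod (f w - f z)%C * Cmod (g z) < e/2/B * B).
  { apply Rle_lt_trans with (e/2/B * Cmod (g z)).
    - apply Rmult_le_compat_r; [apply Cmod_ge_0|lra].
    - apply Rmult_lt_compat_l; [repeat apply Rdiv_lt_0_compat; lra|unfold B; lra]. }
  replace (A * (e/2/A)) with (e/2) in E1 by (field; lra).
  replace (e/2/B*B) with (e/2) in E2 by (field; lra). lra.
Qed.

Lemma ccont_neq0 (g : C -> C) (z : C) :
  ccont g z -> g z <> 0%C -> exists d, 0 < d /\
    forall w, Cmod (w - z)%C < d -> Cmod (g z) / 2 < Cmod (g w).
Proof.
  intros Hg H0. apply Cmod_pos_neq in H0.
  destruct (Hg (Cmod (g z) / 2)) as [d [D H]]; [lra|].
  exists d. split; [exact D|]. intros w Hw. specialize (H w Hw).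
  generalize (Cmod_le_add_sub (g z) (g w)). rewrite Cmod_sub_sym in H. lra.
Qed.

Lemma ccont_inv (g : C -> C) (z : C) :
  ccont g z -> g z <> 0%C -> ccont (fun w => / g w)%C z.
Proof.
  intros Hg H0 e He. assert (P := Cmod_pos_neq _ H0). set (m := Cmod (g z)) in *.
  destruct (ccont_neq0 g z Hg H0) as [d1 [D1 H1]]. fold m in H1.
  destruct (Hg (e * (m/2) * m)) as [d2 [D2 H2]].
  { repeat apply Rmult_lt_0_compat; lra. }
  exists (Rmin d1 d2). split; [now apply Rmin_pos|]. intros w Hw.
  specialize (H1 w (Rlt_le_trans _ _ _ Hw (Rmin_l _ _))).
  specialize (H2 w (Rlt_le_trans _ _ _ Hw (Rmin_r _ _))).
  assert (Hn : g w <> 0%C). { apply Cmod_gt_0. lra. }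
  replace (/ g w - / g z)%C with ((g z - g w) * / (g w * g z))%C by (field; auto).
  rewrite Cmod_mult, Cmod_inv by (apply Cmult_neq_0; auto).
  rewrite Cmod_mult, Cmod_sub_sym. fold m.
  apply Rmult_lt_reg_r with (Cmod (g w) * m); [apply Rmult_lt_0_compat; lra|].
  rewrite Rmult_assoc, Rinv_l, Rmult_1_r by (apply Rmult_integral_contrapositive; lra).
  eapply Rlt_le_trans; [exact H2|]. rewrite Rmult_assoc.
  apply Rmult_le_compat_l; [lra|]. apply Rmult_le_compat_r; lra.
Qed.

Lemma ccont_comp (f g : C -> C) (z : C) :
  ccont g z -> ccont f (g z) -> ccont (fun w => f (g w)) z.
Proof.
  intros Hg Hf e He. destruct (Hf e He) as [d [D H]].
  destruct (Hg d D) as [d' [D' H']]. exists d'. auto.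
Qed.

Lemma ccont_ext_loc (f g : C -> C) (z : C) (d : R) : 0 < d ->
  (forall w, Cmod (w - z)%C < d -> f w = g w) -> ccont f z -> ccont g z.
Proof.
  intros Hd E Hf e He. destruct (Hf e He) as [d' [D' H']].
  exists (Rmin d d'). split; [now apply Rmin_pos|]. intros w Hw.
  rewrite <- !E.
  - apply H'. eapply Rlt_le_trans; [exact Hw|apply Rmin_r].
  - replace (z - z)%C with (RtoC 0) by ring. now rewrite Cmod_0.
  - eapply Rlt_le_trans; [exact Hw|apply Rmin_l].
Qed.

Lemma ccont_opp (f : C -> C) (z : C) : ccont f z -> ccont (fun w => - f w)%C z.
Proof.
  intros H e He. destruct (H e He) as [d [D H']]. exists d. split; [exact D|].
  intros w Hw. replace (- f w - - f z)%C with (- (f w - f z))%C by ring.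
  rewrite Cmod_opp. auto.
Qed.

Lemma ccont_minus (f g : C -> C) (z : C) :
  ccont f z -> ccont g z -> ccont (fun w => f w - g w)%C z.
Proof. intros Hf Hg. apply ccont_plus; [exact Hf|now apply ccont_opp]. Qed.

Lemma cdiff_ccont (f : C -> C) (z : C) : cdiff f z -> ccont f z.
Proof.
  intros [q [Hq E]].
  apply ccont_ext_loc with (f := fun w => (f z + q w * (w - z))%C) (d := 1); [lra|auto|].
  apply ccont_plus; [apply ccont_const|]. apply ccont_mult; [exact Hq|].
  apply ccont_minus; [apply ccont_id|apply ccont_const].
Qed.

Lemma cdiff_const (c z : C) : cdiff (fun _ => c) z.
Proof.
  exists (fun _ => 0%C). split; [apply ccont_const|]. intros w. ring.
Qed.

Lemma cdiff_id (z : C) : cdiff (fun w => w) z.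
Proof.
  exists (fun _ => 1%C). split; [apply ccont_const|]. intros w. ring.
Qed.

Lemma cdiff_plus (f g : C -> C) (z : C) :
  cdiff f z -> cdiff g z -> cdiff (fun w => f w + g w)%C z.
Proof.
  intros [q [Hq E]] [p [Hp F]]. exists (fun w => q w + p w)%C. split.
  - now apply ccont_plus.
  - intros w. rewrite (E w), (F w) at 1. ring.
Qed.

Lemma cdiff_mult (f g : C -> C) (z : C) :
  cdiff f z -> cdiff g z -> cdiff (fun w => f w * g w)%C z.
Proof.
  intros Hf Hg. assert (Cf := cdiff_ccont f z Hf).
  destruct Hf as [q [Hq E]], Hg as [p [Hp F]].
  exists (fun w => q w * g z + f w * p w)%C. split.
  - apply ccont_plus; apply ccont_mult; auto using ccont_const.
  - intros w. rewrite (F w), (E w) at 1. rewrite (E w). ring.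
Qed.

Lemma cdiff_minus (f g : C -> C) (z : C) :
  cdiff f z -> cdiff g z -> cdiff (fun w => f w - g w)%C z.
Proof.
  intros [q [Hq E]] [p [Hp F]]. exists (fun w => q w - p w)%C. split.
  - now apply ccont_minus.
  - intros w. rewrite (E w), (F w) at 1. ring.
Qed.

Lemma cdiff_ext_loc (f g : C -> C) (z : C) (d : R) : 0 < d ->
  (forall w, Cmod (w - z)%C < d -> f w = g w) -> cdiff f z -> cdiff g z.
Proof.
  intros Hd E [q [Hq F]].
  assert (Ez : f z = g z).
  { apply E. replace (z - z)%C with (RtoC 0) by ring. now rewrite Cmod_0. }
  exists (fun w => if excluded_middle_informative (w = z) then q z
                   else (g w - g z) / (w - z))%C. split.
  - apply ccont_ext_loc with (f := q) (d := d); [exact Hd| |exact Hq].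
    intros w Hw. destruct (excluded_middle_informative (w = z)) as [->|N]; [reflexivity|].
    rewrite <- (E w Hw), <- Ez, (F w). field. now apply Cminus_neq_0.
  - intros w. destruct (excluded_middle_informative (w = z)) as [->|N]; [ring|].
    field. now apply Cminus_neq_0.
Qed.

Lemma cdiff_inv (g : C -> C) (z : C) :
  cdiff g z -> g z <> 0%C -> cdiff (fun w => / g w)%C z.
Proof.
  intros Hg H0. assert (Cg := cdiff_ccont g z Hg).
  destruct (ccont_neq0 g z Cg H0) as [d [D H]].
  assert (P := Cmod_pos_neq _ H0).
  destruct Hg as [q [Hq E]].
  exists (fun w => if excluded_middle_informative (g w = 0%C)
           then (/ g w - / g z) / (w - z) else - q w * / (g w * g z))%C. split.
  - apply ccont_ext_loc with (f := fun w => (- q w * / (g w * g z))%C) (d := d); [exact D| |].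
    + intros w Hw. destruct (excluded_middle_informative (g w = 0%C)) as [N|N]; [|reflexivity].
      specialize (H w Hw). rewrite N, Cmod_0 in H. lra.
    + apply ccont_mult; [now apply ccont_opp|].
      apply ccont_inv; [|now apply Cmult_neq_0].
      apply ccont_mult; [exact Cg|apply ccont_const].
  - intros w. destruct (excluded_middle_informative (g w = 0%C)) as [N|N].
    + assert (W : w <> z) by (intros ->; contradiction).
      generalize (/ g w)%C (/ g z)%C. intros a b. field. now apply Cminus_neq_0.
    + assert (F := E w).
      replace (- q w * / (g w * g z) * (w - z))%C with (- (q w * (w - z)) * / (g w * g z))%C
        by (field; auto).
      replace (q w * (w - z))%C with (g w - g z)%C by (rewrite F at 1; ring).
      field. auto.
Qed.

Lemma cdiff_comp (f g : C -> C) (z : C) :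
  cdiff g z -> cdiff f (g z) -> cdiff (fun w => f (g w)) z.
Proof.
  intros Hg [p [Hp F]]. assert (Cg := cdiff_ccont g z Hg).
  destruct Hg as [q [Hq E]].
  exists (fun w => p (g w) * q w)%C. split.
  - apply ccont_mult; [|exact Hq]. now apply ccont_comp.
  - intros w. rewrite (F (g w)). replace (g w - g z)%C with (q w * (w - z))%C; [ring|].
    rewrite (E w) at 1. ring.
Qed.

Lemma ex_derive_cdiff (f : C -> C) (z : C) :
  @ex_derive C_AbsRing C_NormedModule f z <-> cdiff f z.
Proof.
  split.
  - intros [l [_ H]]. specialize (H z (fun P HP => HP)).
    exists (fun w => if excluded_middle_informative (w = z) then l
                   else (f w - f z) / (w - z))%C. split.
    + intros e He. assert (He2 : 0 < e/2) by lra.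
      destruct (H (mkposreal _ He2)) as [d Hd]. exists d. split; [apply cond_pos|].
      intros w Hw. specialize (Hd w Hw).
      destruct (excluded_middle_informative (z = z)) as [_|N]; [|now destruct N].
      destruct (excluded_middle_informative (w = z)) as [->|N].
      * replace (l - l)%C with (RtoC 0) by ring. rewrite Cmod_0; lra.
      * assert (Hd' : Cmod (f w - f z - (w - z) * l)%C <= e/2 * Cmod (w - z)%C) by exact Hd.
        assert (P := Cmod_sub_pos z w N).
        replace ((f w - f z)/(w - z) - l)%C with ((f w - f z - (w - z) * l) / (w - z))%C
          by (field; now apply Cminus_neq_0).
        rewrite Cmod_div by (now apply Cminus_neq_0).
        apply Rle_lt_trans with (e/2); [|lra].
        apply Rmult_le_reg_r with (Cmod (w - z)%C); [exact P|].
        unfold Rdiv at 1. rewrite Rmult_assoc, Rinv_l by lra. lra.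
    + intros w. destruct (excluded_middle_informative (w = z)) as [->|N]; [ring|].
      field. now apply Cminus_neq_0.
  - intros [q [Hq E]]. exists (q z). split.
    + apply is_linear_scal_l.
    + intros x Hx.
      assert (Hxz : x = z). { symmetry. exact (@is_filter_lim_locally_unique C_AbsRing (AbsRing_NormedModule C_AbsRing) z x Hx). }
      subst x. intros eps. destruct (Hq eps (cond_pos eps)) as [d [D Hd]].
      exists (mkposreal d D). intros w Hw.
      change (Cmod (f w - f z - (w - z) * q z)%C <= eps * Cmod (w - z)%C).
      replace (f w - f z - (w - z) * q z)%C with ((q w - q z) * (w - z))%C
        by (rewrite (E w) at 1; ring).
      rewrite Cmod_mult. apply Rmult_le_compat_r; [apply Cmod_ge_0|].
      apply Rlt_le, Hd. exact Hw.
Qed.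

(** * Bisection of rectangles *)

Lemma nested_intervals_point (a b : nat -> R) :
  (forall n m, a n <= b m) -> exists x, forall n, a n <= x <= b n.
Proof.
  intros H.
  destruct (completeness (fun x => exists n, x = a n)) as [x [Hu Hl]].
  - exists (b O). intros y [n ->]. apply H.
  - exists (a O), O. reflexivity.
  - exists x. intros n. split.
    + apply Hu. now exists n.
    + apply Hl. intros y [m ->]. apply H.
Qed.

Lemma nested_monotone (a b : nat -> R) :
  (forall n, a n <= a (S n)) -> (forall n, b (S n) <= b n) -> (forall n, a n <= b n) ->
  forall n m, a n <= b m.
Proof.
  intros Ha Hb H n m.
  assert (A : forall k n, a n <= a (n + k)%nat).
  { induction k; intros p; [rewrite PeanoNat.Nat.add_0_r; lra|].
    rewrite PeanoNat.Nat.add_succ_r. eapply Rle_trans; [apply IHk|apply Ha]. }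
  assert (B : forall k n, b (n + k)%nat <= b n).
  { induction k; intros p; [rewrite PeanoNat.Nat.add_0_r; lra|].
    rewrite PeanoNat.Nat.add_succ_r. eapply Rle_trans; [apply Hb|apply IHk]. }
  apply Rle_trans with (a (n + m)%nat); [apply A|].
  apply Rle_trans with (b (n + m)%nat); [apply H|].
  rewrite PeanoNat.Nat.add_comm. apply B.
Qed.

Lemma half_pow_bounds (n : nat) : 0 < (1/2) ^ n <= 1.
Proof.
  split; [apply pow_lt; lra|].
  eapply Rle_trans; [apply (pow_incr _ 1); lra|]. rewrite pow1. lra.
Qed.

Lemma half_pow_small (L eps : R) : 0 < eps -> exists n, L * (1/2) ^ n < eps.
Proof.
  intros He. destruct (pow_lt_1_zero (1/2)) with (y := eps / (Rabs L + 1)) as [n Hn].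
  - rewrite Rabs_pos_eq; lra.
  - apply Rdiv_lt_0_compat; [exact He|]. generalize (Rabs_pos L); lra.
  - exists n. specialize (Hn n (le_n n)).
    assert (P : 0 < (1/2)^n) by (apply pow_lt; lra).
    rewrite Rabs_pos_eq in Hn by lra.
    assert (A := Rabs_pos L). assert (B := Rle_abs L).
    apply Rmult_lt_compat_r with (r := Rabs L + 1) in Hn; [|lra].
    replace (eps / (Rabs L + 1) * (Rabs L + 1)) with eps in Hn by (field; lra). nra.
Qed.

(** The principle behind both the theorem of Goursat and the existence of maxima
    on a disk: a property of rectangles that passes to one of the four quarters
    holds for arbitrarily small rectangles around some point. *)
Lemma rectangle_bisection (P : R -> R -> R -> R -> Prop) (a b c d : R) :
  a <= b -> c <= d -> P a b c d ->
  (forall a' b' c' d', a <= a' -> a' <= b' -> b' <= b -> c <= c' -> c' <= d' -> d' <= d ->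
    P a' b' c' d' ->
    P a' ((a'+b')/2) c' ((c'+d')/2) \/ P ((a'+b')/2) b' c' ((c'+d')/2) \/
    P a' ((a'+b')/2) ((c'+d')/2) d' \/ P ((a'+b')/2) b' ((c'+d')/2) d') ->
  exists x y, a <= x <= b /\ c <= y <= d /\
    forall eps, 0 < eps -> exists a' b' c' d', P a' b' c' d' /\
      a <= a' <= x /\ x <= b' <= b /\ c <= c' <= y /\ y <= d' <= d /\
      b' - a' < eps /\ d' - c' < eps.
Proof.
  intros Hab Hcd HP Hsplit.
  set (good := fun s : (R * R) * (R * R) =>
    let '((a', b'), (c', d')) := s in
    a <= a' /\ a' <= b' /\ b' <= b /\ c <= c' /\ c' <= d' /\ d' <= d /\ P a' b' c' d').
  set (refines := fun s s' : (R * R) * (R * R) =>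
    good s' /\ fst (fst s) <= fst (fst s') /\ snd (fst s') <= snd (fst s) /\
    fst (snd s) <= fst (snd s') /\ snd (snd s') <= snd (snd s) /\
    snd (fst s') - fst (fst s') = (snd (fst s) - fst (fst s)) / 2 /\
    snd (snd s') - fst (snd s') = (snd (snd s) - fst (snd s)) / 2).
  assert (Hstep : forall s, exists s', good s -> refines s s').
  { intros s. destruct (classic (good s)) as [G|G]; [|exists s; tauto].
    destruct s as [[a' b'] [c' d']].
    destruct G as (G1 & G2 & G3 & G4 & G5 & G6 & G7).
    destruct (Hsplit a' b' c' d' G1 G2 G3 G4 G5 G6 G7) as [H|[H|[H|H]]].
    - exists ((a', (a'+b')/2), (c', (c'+d')/2)). intros _. unfold refines; simpl.
      repeat split; try exact H; lra.
    - exists (((a'+b')/2, b'), (c', (c'+d')/2)). intros _. unfold refines; simpl.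
      repeat split; try exact H; lra.
    - exists ((a', (a'+b')/2), ((c'+d')/2, d')). intros _. unfold refines; simpl.
      repeat split; try exact H; lra.
    - exists (((a'+b')/2, b'), ((c'+d')/2, d')). intros _. unfold refines; simpl.
      repeat split; try exact H; lra. }
  set (next := fun s => proj1_sig (constructive_indefinite_description _ (Hstep s))).
  assert (Hnext : forall s, good s -> refines s (next s)).
  { intros s. exact (proj2_sig (constructive_indefinite_description _ (Hstep s))). }
  set (s := fix s n := match n with O => ((a, b), (c, d)) | S m => next (s m) end).
  assert (Hg : forall n, good (s n)).
  { induction n; [simpl; repeat split; trivial; lra|]. exact (proj1 (Hnext _ IHn)). }
  assert (Hr : forall n, refines (s n) (s (S n))) by (intros n; apply Hnext, Hg).
  assert (Hlen : forall n, snd (fst (s n)) - fst (fst (s n)) = (b - a) * (1/2)^n /\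
                           snd (snd (s n)) - fst (snd (s n)) = (d - c) * (1/2)^n).
  { induction n; [simpl; lra|]. destruct (Hr n) as (_ & _ & _ & _ & _ & E1 & E2).
    rewrite E1, E2. destruct IHn as [-> ->]. simpl pow. lra. }
  assert (Hord : forall n, fst (fst (s n)) <= snd (fst (s n)) /\ fst (snd (s n)) <= snd (snd (s n))).
  { intros n. generalize (Hg n). destruct (s n) as [[? ?] [? ?]]; simpl. tauto. }
  destruct (nested_intervals_point (fun n => fst (fst (s n))) (fun n => snd (fst (s n)))) as [x Hx].
  { apply nested_monotone; intros n; try apply (Hr n). apply Hord. }
  destruct (nested_intervals_point (fun n => fst (snd (s n))) (fun n => snd (snd (s n)))) as [y Hy].
  { apply nested_monotone; intros n; try apply (Hr n). apply Hord. }
  exists x, y. split; [exact (Hx O)|]. split; [exact (Hy O)|].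
  intros eps He.
  destruct (half_pow_small ((b - a) + (d - c)) eps He) as [n Hn].
  exists (fst (fst (s n))), (snd (fst (s n))), (fst (snd (s n))), (snd (snd (s n))).
  assert (Pn : 0 < (1/2)^n) by (apply pow_lt; lra).
  generalize (Hg n) (Hlen n) (Hx n) (Hy n).
  destruct (s n) as [[a' b'] [c' d']]; simpl.
  intros (G1 & G2 & G3 & G4 & G5 & G6 & G7) [L1 L2] X Y.
  repeat split; try lra; try exact G7; rewrite ?L1, ?L2; nra.
Qed.

(** * The theorem of Goursat on a rectangle *)

(** The real part of the integral of [g] along the boundary of the rectangle with
    sides [a, b] and [c, d], the integrals over opposite sides being grouped. *)
Definition boundary_int (g : C -> C) (a b c d : R) : R :=
  RInt (fun x => fst (g (x, c)) - fst (g (x, d))) a b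
  - RInt (fun y => snd (g (b, y)) - snd (g (a, y))) c d.

Lemma Cmod_fst (z : C) : Rabs (fst z) <= Cmod z.
Proof. eapply Rle_trans; [apply Rmax_l|apply Rmax_Cmod]. Qed.

Lemma Cmod_snd (z : C) : Rabs (snd z) <= Cmod z.
Proof. eapply Rle_trans; [apply Rmax_r|apply Rmax_Cmod]. Qed.

Lemma Cmod_le_abs (z : C) : Cmod z <= Rabs (fst z) + Rabs (snd z).
Proof.
  assert (A := Rabs_pos (fst z)). assert (B := Rabs_pos (snd z)).
  apply sq_le_sq; [lra|]. rewrite Cmod_sq.
  rewrite <- (pow2_abs (fst z)), <- (pow2_abs (snd z)). nra.
Qed.

Lemma continuous_eps (f : R -> R) (x : R) :
  (forall eps, 0 < eps -> exists d, 0 < d /\ forall y, Rabs (y - x) < d -> Rabs (f y - f x) < eps) ->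
  continuous f x.
Proof.
  intros H. apply filterlim_locally. intros eps.
  destruct (H eps (cond_pos eps)) as [d [D Hd]].
  exists (mkposreal d D). intros y Hy. apply Hd. exact Hy.
Qed.

Lemma continuous_path (f : C -> C) (p : R -> C) (t : R) :
  ccont f (p t) ->
  (forall s, Cmod (p s - p t)%C <= Rabs (s - t)) ->
  continuous (fun s => fst (f (p s))) t /\ continuous (fun s => snd (f (p s))) t.
Proof.
  intros Hf Hp. split; apply continuous_eps; intros eps He;
  destruct (Hf eps He) as [d [D H]]; exists d; (split; [exact D|]); intros y Hy.
  - change (Rabs (fst (f (p y) - f (p t))%C) < eps).
    eapply Rle_lt_trans; [apply Cmod_fst|]. apply H.
    eapply Rle_lt_trans; [apply Hp|exact Hy].
  - change (Rabs (snd (f (p y) - f (p t))%C) < eps).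
    eapply Rle_lt_trans; [apply Cmod_snd|]. apply H.
    eapply Rle_lt_trans; [apply Hp|exact Hy].
Qed.

Lemma continuous_horizontal (f : C -> C) (x y : R) : ccont f (x, y) ->
  continuous (fun s => fst (f (s, y))) x.
Proof.
  intros H. apply (continuous_path f (fun s => (s, y)) x H).
  intros s. eapply Rle_trans; [apply Cmod_le_abs|]. simpl.
  replace (y + - y) with 0 by ring. rewrite Rabs_R0. unfold Rminus. lra.
Qed.

Lemma continuous_vertical (f : C -> C) (x y : R) : ccont f (x, y) ->
  continuous (fun s => snd (f (x, s))) y.
Proof.
  intros H. apply (continuous_path f (fun s => (x, s)) y H).
  intros s. eapply Rle_trans; [apply Cmod_le_abs|]. simpl.
  replace (x + - x) with 0 by ring. rewrite Rabs_R0. unfold Rminus. lra.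
Qed.

Definition ccont_rect (g : C -> C) (a b c d : R) : Prop :=
  forall x y, a <= x <= b -> c <= y <= d -> ccont g (x, y).

Lemma ex_RInt_fst (g : C -> C) (a b c d x x' y : R) :
  ccont_rect g a b c d -> a <= x -> x <= x' -> x' <= b -> c <= y <= d ->
  ex_RInt (fun s => fst (g (s, y))) x x'.
Proof.
  intros H H1 H2 H3 H4. apply (@ex_RInt_continuous R_CompleteNormedModule).
  intros z. rewrite Rmin_left, Rmax_right by lra. intros Hz.
  apply continuous_horizontal, H; lra.
Qed.

Lemma ex_RInt_snd (g : C -> C) (a b c d x y y' : R) :
  ccont_rect g a b c d -> c <= y -> y <= y' -> y' <= d -> a <= x <= b ->
  ex_RInt (fun s => snd (g (x, s))) y y'.
Proof.
  intros H H1 H2 H3 H4. apply (@ex_RInt_continuous R_CompleteNormedModule).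
  intros z. rewrite Rmin_left, Rmax_right by lra. intros Hz.
  apply continuous_vertical, H; lra.
Qed.

Lemma RInt_minus_R (f h : R -> R) (a b : R) : ex_RInt f a b -> ex_RInt h a b ->
  RInt (fun x => f x - h x) a b = RInt f a b - RInt h a b.
Proof. intros. exact (@RInt_minus R_CompleteNormedModule f h a b H H0). Qed.

Lemma RInt_Chasles_R (f : R -> R) (a b c : R) : ex_RInt f a b -> ex_RInt f b c ->
  RInt f a c = RInt f a b + RInt f b c.
Proof. intros. symmetry. exact (@RInt_Chasles R_CompleteNormedModule f a b c H H0). Qed.

Lemma boundary_int_split (g : C -> C) (a b c d m n : R) :
  ccont_rect g a b c d -> a <= m -> m <= b -> c <= n -> n <= d ->
  boundary_int g a b c d =
    boundary_int g a m c n + boundary_int g m b c n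
    + boundary_int g a m n d + boundary_int g m b n d.
Proof.
  intros H H1 H2 H3 H4. unfold boundary_int.
  rewrite !(RInt_minus_R (fun x => fst (g (x, _))))
    by (eapply ex_RInt_fst; [exact H|lra..]).
  rewrite !(RInt_minus_R (fun y => snd (g (_, y))))
    by (eapply ex_RInt_snd; [exact H|lra..]).
  rewrite (RInt_Chasles_R (fun x => fst (g (x, c))) a m b), (RInt_Chasles_R (fun x => fst (g (x, d))) a m b)
    by (eapply ex_RInt_fst; [exact H|lra..]).
  rewrite (RInt_Chasles_R (fun y => snd (g (a, y))) c n d), (RInt_Chasles_R (fun y => snd (g (b, y))) c n d)
    by (eapply ex_RInt_snd; [exact H|lra..]).
  ring.
Qed.

Lemma RInt_near_const (f : R -> R) (a b K e : R) : a <= b -> ex_RInt f a b ->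
  (forall x, a <= x <= b -> Rabs (f x - K) <= e) ->
  Rabs (RInt f a b - K * (b - a)) <= e * (b - a).
Proof.
  intros Hab Hf H.
  assert (E : forall k, RInt (fun _ => k) a b = k * (b - a)).
  { intros k. rewrite RInt_const. unfold scal; simpl; unfold mult; simpl. ring. }
  apply Rabs_le. split.
  - cut ((K - e) * (b - a) <= RInt f a b); [lra|]. rewrite <- E.
    apply RInt_le; [exact Hab|apply ex_RInt_const|exact Hf|].
    intros x Hx. specialize (H x ltac:(lra)). apply Rabs_le_between in H. lra.
  - cut (RInt f a b <= (K + e) * (b - a)); [lra|]. rewrite <- E.
    apply RInt_le; [exact Hab|exact Hf|apply ex_RInt_const|].
    intros x Hx. specialize (H x ltac:(lra)). apply Rabs_le_between in H. lra.
Qed.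

Lemma Rabs_components_le (z w : C) (e : R) : Cmod (z - w)%C <= e ->
  Rabs (fst z - fst w) <= e /\ Rabs (snd z - snd w) <= e.
Proof.
  intros H. split.
  - eapply Rle_trans; [apply (Cmod_fst (z - w)%C)|exact H].
  - eapply Rle_trans; [apply (Cmod_snd (z - w)%C)|exact H].
Qed.

(** An affine function has boundary integral 0: the two integrals are both
    [(b - a) * (d - c)] times the imaginary part of [l].  Only the error remains. *)
Lemma boundary_int_near_affine (g : C -> C) (l z0 : C) (a b c d e : R) :
  a <= b -> c <= d -> ccont_rect g a b c d ->
  (forall x y, a <= x <= b -> c <= y <= d ->
     Cmod (g (x, y) - (z0 + l * (x, y)))%C <= e) ->
  Rabs (boundary_int g a b c d) <= 2 * e * ((b - a) + (d - c)).
Proof.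
  intros Hab Hcd Hc H. unfold boundary_int.
  assert (H1 : Rabs (RInt (fun x => fst (g (x, c)) - fst (g (x, d))) a b - (snd l * (d - c)) * (b - a)) <= 2 * e * (b - a)).
  { apply RInt_near_const; [exact Hab| |].
    - apply (@ex_RInt_minus R_NormedModule); eapply ex_RInt_fst; try exact Hc; lra.
    - intros x Hx.
      destruct (Rabs_components_le _ _ _ (H x c Hx ltac:(lra))) as [U _].
      destruct (Rabs_components_le _ _ _ (H x d Hx ltac:(lra))) as [V _].
      simpl in U, V. apply Rabs_le_between in U. apply Rabs_le_between in V.
      apply Rabs_le. lra. }
  assert (H2 : Rabs (RInt (fun y => snd (g (b, y)) - snd (g (a, y))) c d - (snd l * (b - a)) * (d - c)) <= 2 * e * (d - c)).
  { apply RInt_near_const; [exact Hcd| |].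
    - apply (@ex_RInt_minus R_NormedModule); eapply ex_RInt_snd; try exact Hc; lra.
    - intros y Hy.
      destruct (Rabs_components_le _ _ _ (H b y ltac:(lra) Hy)) as [_ U].
      destruct (Rabs_components_le _ _ _ (H a y ltac:(lra) Hy)) as [_ V].
      simpl in U, V. apply Rabs_le_between in U. apply Rabs_le_between in V.
      apply Rabs_le. lra. }
  apply Rabs_le_between in H1. apply Rabs_le_between in H2. apply Rabs_le. lra.
Qed.

(** A nonzero integral would force, by bisection, integrals at least [K] times the
    squared half-perimeter on arbitrarily small rectangles around some point;
    there [g] is affine up to [K / 4] times the half-perimeter. *)
Lemma goursat (g : C -> C) (a b c d : R) : a <= b -> c <= d ->
  (forall x y, a <= x <= b -> c <= y <= d -> cdiff g (x, y)) ->
  boundary_int g a b c d = 0.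
Proof.
  intros Hab Hcd Hg.
  assert (Hc : ccont_rect g a b c d) by (intros x y Hx Hy; now apply cdiff_ccont, Hg).
  apply NNPP. intros N. apply Rabs_pos_lt in N.
  set (S0 := (b - a) + (d - c)).
  assert (HS : 0 < S0).
  { destruct (Rle_lt_dec S0 0) as [L|L]; [|exact L]. exfalso. unfold S0 in L.
    assert (b = a) by lra. assert (d = c) by lra. subst b d. revert N.
    unfold boundary_int. rewrite !RInt_point. unfold zero; simpl.
    rewrite Rminus_0_r, Rabs_R0. lra. }
  set (K := Rabs (boundary_int g a b c d) / S0 ^ 2).
  assert (HS2 : 0 < S0 ^ 2) by (apply pow_lt; lra).
  assert (HK : 0 < K) by (apply Rdiv_lt_0_compat; lra).
  destruct (rectangle_bisection (fun a' b' c' d' =>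
      0 < (b' - a') + (d' - c') /\
      K * ((b' - a') + (d' - c')) ^ 2 <= Rabs (boundary_int g a' b' c' d')) a b c d)
    as (x & y & Hx & Hy & H); trivial.
  - split; [exact HS|]. fold S0. unfold K. apply Req_le. field. lra.
  - intros a' b' c' d' G1 G2 G3 G4 G5 G6 [P1 P2].
    assert (Hc' : ccont_rect g a' b' c' d') by (intros u v Hu Hv; apply Hc; lra).
    rewrite (boundary_int_split g a' b' c' d' ((a'+b')/2) ((c'+d')/2)) in P2 by (trivial; lra).
    apply NNPP. intros Q. apply not_or_and in Q. destruct Q as [Q1 Q].
    apply not_or_and in Q. destruct Q as [Q2 Q].
    apply not_or_and in Q. destruct Q as [Q3 Q4].
    assert (T : forall p w : R, ~ (0 < p /\ K * p ^ 2 <= w) -> 0 < p -> w < K * p ^ 2).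
    { intros p w A B. apply Rnot_le_lt. tauto. }
    apply T in Q1; [|lra]. apply T in Q2; [|lra]. apply T in Q3; [|lra]. apply T in Q4; [|lra].
    revert P2. apply Rlt_not_le.
    eapply Rle_lt_trans; [apply Rabs_triang|].
    eapply Rle_lt_trans; [apply Rplus_le_compat_r, Rabs_triang|].
    eapply Rle_lt_trans; [apply Rplus_le_compat_r, Rplus_le_compat_r, Rabs_triang|].
    lra.
  - destruct (Hg x y Hx Hy) as [q [Hq E]].
    destruct (Hq (K / 4)) as [r [Hr Hq']]; [lra|].
    destruct (H (r / 2)) as (a' & b' & c' & d' & [P1 P2] & A1 & A2 & A3 & A4 & A5 & A6); [lra|].
    assert (B := boundary_int_near_affine g (q (x, y)) (g (x, y) - q (x, y) * (x, y))%C a' b' c' d'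
      (K / 4 * ((b' - a') + (d' - c')))).
    cut (2 * (K / 4 * (b' - a' + (d' - c'))) * (b' - a' + (d' - c')) < K * (b' - a' + (d' - c')) ^ 2).
    + intros L. apply (Rlt_not_le _ _ L). eapply Rle_trans; [exact P2|]. apply B; try lra.
      * intros u v Hu Hv; apply Hc; lra.
      * intros u v Hu Hv.
        assert (M : Cmod ((u, v) - (x, y))%C <= (b' - a') + (d' - c')).
        { eapply Rle_trans; [apply Cmod_le_abs|]. simpl.
          apply Rplus_le_compat; apply Rabs_le; lra. }
        rewrite (E (u, v)).
        replace (g (x, y) + q (u, v) * ((u, v) - (x, y)) - (g (x, y) - q (x, y) * (x, y) + q (x, y) * (u, v)))%C
          with ((q (u, v) - q (x, y)) * ((u, v) - (x, y)))%C by ring.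
        rewrite Cmod_mult. apply Rmult_le_compat; try apply Cmod_ge_0; [|exact M].
        apply Rlt_le, Hq'. lra.
    + assert (0 < K * (b' - a' + (d' - c')) ^ 2) by (apply Rmult_lt_0_compat; [lra|apply pow_lt; lra]).
      lra.
Qed.

(** * The mean value property *)

Definition cexp (w : C) : C := (exp (fst w) * cos (snd w), exp (fst w) * sin (snd w)).

Lemma cexp_plus (z w : C) : cexp (z + w)%C = (cexp z * cexp w)%C.
Proof.
  unfold cexp, Cplus, Cmult; simpl. rewrite exp_plus, cos_plus, sin_plus.
  f_equal; ring.
Qed.

Lemma Cmod_cexp (w : C) : Cmod (cexp w) = exp (fst w).
Proof.
  unfold cexp, Cmod; simpl.
  replace (exp (fst w) * cos (snd w) * (exp (fst w) * cos (snd w) * 1) +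
           exp (fst w) * sin (snd w) * (exp (fst w) * sin (snd w) * 1))
    with (exp (fst w) ^ 2 * (Rsqr (sin (snd w)) + Rsqr (cos (snd w)))) by (unfold Rsqr; ring).
  rewrite sin2_cos2, Rmult_1_r. apply sqrt_pow2, Rlt_le, exp_pos.
Qed.

Lemma exp_second_order (a : R) : Rabs a <= 1/2 -> Rabs (exp a - 1 - a) <= 2 * a ^ 2.
Proof.
  intros H. apply Rabs_le_between in H.
  assert (L := exp_ineq1_le a). assert (M := exp_ineq1_le (- a)).
  assert (P := exp_pos a).
  assert (U : exp a * (1 - a) <= 1).
  { replace 1 with (exp a * exp (- a)) at 2 by (rewrite <- exp_plus, Rplus_opp_r; apply exp_0).
    apply Rmult_le_compat_l; lra. }
  rewrite Rabs_pos_eq by lra.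
  assert (exp a <= 2). { nra. }
  assert (exp a - 1 <= a * exp a) by lra.
  destruct (Rle_lt_dec 0 a); nra.
Qed.

Lemma cos_second_order (b : R) : Rabs (cos b - 1) <= b ^ 2.
Proof.
  assert (E : cos b = 1 - 2 * sin (b / 2) ^ 2).
  { replace b with (2 * (b / 2)) at 1 by field. rewrite cos_2a_sin. ring. }
  rewrite E. replace (1 - 2 * sin (b/2) ^ 2 - 1) with (- (2 * sin (b/2) ^ 2)) by ring.
  rewrite Rabs_Ropp, Rabs_pos_eq by (apply Rmult_le_pos; [lra|apply pow2_ge_0]).
  assert (Rabs (sin (b/2)) <= Rabs (b/2)).
  { destruct (MVT_gen sin 0 (b/2) cos) as [c [_ Hc]].
    - intros x _. auto_derive; [trivial|ring].
    - intros x _. apply continuity_pt_filterlim. apply continuous_sin.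
    - rewrite sin_0, !Rminus_0_r in Hc. rewrite Hc, Rabs_mult.
      assert (Rabs (cos c) <= 1) by (apply Rabs_le, COS_bound).
      generalize (Rabs_pos (b/2)). nra. }
  rewrite <- pow2_abs. rewrite <- (pow2_abs b).
  rewrite Rabs_div, (Rabs_pos_eq 2) in H by lra.
  generalize (Rabs_pos (sin (b/2))) (Rabs_pos b). nra.
Qed.

Lemma sin_second_order (b : R) : Rabs b <= 1 -> Rabs (sin b - b) <= b ^ 2.
Proof.
  intros Hb.
  destruct (MVT_gen (fun x => sin x - x) 0 b (fun x => cos x - 1)) as [c [Hc E]].
  - intros x _. auto_derive; [trivial|ring].
  - intros x _. apply continuity_pt_filterlim. apply (@continuous_minus R_UniformSpace R_AbsRing R_NormedModule);
     [apply continuous_sin|apply continuous_id].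
  - rewrite sin_0 in E. replace (sin b - b) with ((cos c - 1) * (b - 0)) by lra.
    rewrite Rminus_0_r, Rabs_mult.
    assert (A := cos_second_order c).
    assert (Rabs c <= Rabs b).
    { revert Hc. unfold Rmin, Rmax. destruct (Rle_dec 0 b) as [L|L]; intros Hc.
      - rewrite !Rabs_pos_eq; lra.
      - rewrite !Rabs_left1; lra. }
    rewrite <- (pow2_abs c) in A. rewrite <- (pow2_abs b).
    generalize (Rabs_pos c) (Rabs_pos b). intros.
    apply Rle_trans with (Rabs c ^ 2 * Rabs b); [apply Rmult_le_compat_r; lra|].
    assert (Rabs c ^ 2 <= Rabs b) by nra. nra.
Qed.

Lemma cexp_second_order (h : C) : Cmod h <= 1/2 -> Cmod (cexp h - 1 - h)%C <= 8 * Cmod h ^ 2.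
Proof.
  intros H. destruct h as [a b].
  assert (Ha := Rle_trans _ _ _ (Cmod_fst (a, b)) H).
  assert (Hb := Rle_trans _ _ _ (Cmod_snd (a, b)) H). simpl in Ha, Hb.
  eapply Rle_trans; [apply Cmod_le_abs|]. rewrite Cmod_sq. unfold cexp; simpl fst; simpl snd.
  assert (A := exp_second_order a Ha). assert (B := cos_second_order b).
  assert (D := sin_second_order b ltac:(lra)).
  replace (exp a * cos b + - (1) + - a) with ((exp a - 1 - a) + exp a * (cos b - 1)) by ring.
  replace (exp a * sin b + - 0 + - b) with (exp a * (sin b - b) + ((exp a - 1 - a) * b + a * b)) by ring.
  assert (P := exp_pos a).
  assert (exp a <= 2).
  { apply Rabs_le_between in Ha. apply Rabs_le_between in A. nra. }
  assert (T1 : Rabs (exp a * (cos b - 1)) <= 2 * b ^ 2).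
  { rewrite Rabs_mult, (Rabs_pos_eq (exp a)) by lra. apply Rmult_le_compat; try lra. apply Rabs_pos. }
  assert (T2 : Rabs (exp a * (sin b - b)) <= 2 * b ^ 2).
  { rewrite Rabs_mult, (Rabs_pos_eq (exp a)) by lra. apply Rmult_le_compat; try lra. apply Rabs_pos. }
  assert (T3 : Rabs ((exp a - 1 - a) * b) <= 2 * a ^ 2 * (1/2)).
  { rewrite Rabs_mult. apply Rmult_le_compat; try lra; apply Rabs_pos. }
  assert (T4 : Rabs (a * b) <= a ^ 2 + b ^ 2).
  { apply Rabs_le. nra. }
  generalize (Rabs_triang (exp a - 1 - a) (exp a * (cos b - 1))).
  generalize (Rabs_triang (exp a * (sin b - b)) ((exp a - 1 - a) * b + a * b)).
  generalize (Rabs_triang ((exp a - 1 - a) * b) (a * b)).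
  generalize (pow2_ge_0 a) (pow2_ge_0 b). lra.
Qed.

Lemma cexp_0 : cexp 0 = 1%C.
Proof. unfold cexp; simpl. rewrite exp_0, cos_0, sin_0. unfold RtoC. f_equal; ring. Qed.

(** By the functional equation this only concerns [(cexp h - 1) / h] near 0. *)
Lemma cdiff_cexp (z : C) : cdiff cexp z.
Proof.
  set (k := fun h : C => if excluded_middle_informative (h = 0%C) then RtoC 1 else ((cexp h - 1) / h)%C).
  assert (Hk : ccont k 0%C).
  { intros e He. exists (Rmin (1/2) (e/8)). split; [apply Rmin_pos; lra|].
    intros h Hh. replace (h - 0)%C with h in Hh by ring.
    assert (H1 := Rlt_le_trans _ _ _ Hh (Rmin_l _ _)).
    assert (H2 := Rlt_le_trans _ _ _ Hh (Rmin_r _ _)).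
    unfold k. destruct (excluded_middle_informative (RtoC 0 = 0%C)) as [_|N]; [|now destruct N].
    destruct (excluded_middle_informative (h = 0%C)) as [->|N].
    - replace (1 - 1)%C with (RtoC 0) by ring. rewrite Cmod_0. exact He.
    - assert (P := Cmod_pos_neq h N).
      replace ((cexp h - 1)/h - 1)%C with ((cexp h - 1 - h)/h)%C by (field; exact N).
      rewrite Cmod_div by exact N.
      apply Rle_lt_trans with (8 * Cmod h); [|lra].
      apply Rmult_le_reg_r with (Cmod h); [exact P|].
      unfold Rdiv. rewrite Rmult_assoc, Rinv_l, Rmult_1_r by lra.
      eapply Rle_trans; [apply cexp_second_order; lra|]. right; ring. }
  exists (fun w => cexp z * k (w - z))%C. split.
  - apply ccont_mult; [apply ccont_const|].
    apply (ccont_comp k (fun w => (w - z)%C)).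
    + apply ccont_minus; [apply ccont_id|apply ccont_const].
    + replace (z - z)%C with (RtoC 0) by ring. exact Hk.
  - intros w. replace w with (z + (w - z))%C at 1 by ring. rewrite cexp_plus.
    unfold k. destruct (excluded_middle_informative ((w - z)%C = 0%C)) as [->|N].
    + rewrite cexp_0. ring.
    + field. exact N.
Qed.

Definition circle_pt (z0 : C) (r t : R) : C := Cplus z0 (r * cos t, r * sin t).

Lemma Cmod_circle (z0 : C) (r t : R) : 0 <= r -> Cmod (circle_pt z0 r t - z0)%C = r.
Proof.
  intros Hr. unfold circle_pt. set (p := (r * cos t, r * sin t) : C).
  replace (z0 + p - z0)%C with p by ring. unfold p.
  unfold Cmod; simpl.
  replace (r * cos t * (r * cos t * 1) + r * sin t * (r * sin t * 1))
    with (r ^ 2 * (Rsqr (sin t) + Rsqr (cos t))) by (unfold Rsqr; ring).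
  rewrite sin2_cos2, Rmult_1_r. now apply sqrt_pow2.
Qed.

(** In the coordinate [w] with [z = z0 + cexp w], the punctured disk is covered
    by a half plane, and the circles around [z0] by vertical segments of length
    [2 * PI].
    The two horizontal sides of a rectangle of that height give the same
    integral, so that Goursat makes the integral over a circle independent of
    its radius; small radii give the value at [z0] by continuity alone. *)
Lemma mean_value (h : C -> C) (z0 : C) (R0 r : R) : 0 < r < R0 -> ccont h z0 ->
  (forall z, z <> z0 -> Cmod (z - z0)%C < R0 -> cdiff h z) ->
  is_RInt (fun t => snd (h (circle_pt z0 r t))) 0 (2 * PI) (2 * PI * snd (h z0)).
Proof.
  intros Hr Hc Hd. assert (Hpi := PI_RGT_0).
  set (g := fun w => h (z0 + cexp w)%C).
  assert (Hne : forall w, (z0 + cexp w)%C <> z0).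
  { intros w E. assert (cexp w = 0%C).
    { replace (cexp w) with ((z0 + cexp w) - z0)%C by ring. rewrite E. ring. }
    assert (F := Cmod_cexp w). rewrite H, Cmod_0 in F. generalize (exp_pos (fst w)); lra. }
  assert (Hg : forall x y, exp x < R0 -> cdiff g (x, y)).
  { intros x y Hx. unfold g. apply (cdiff_comp h (fun w => (z0 + cexp w)%C)).
    - apply cdiff_plus; [apply cdiff_const|apply cdiff_cexp].
    - apply Hd; [apply Hne|]. replace (z0 + cexp (x, y) - z0)%C with (cexp (x, y)) by ring.
      rewrite Cmod_cexp. exact Hx. }
  set (I := fun x => RInt (fun y => snd (g (x, y))) 0 (2 * PI)).
  assert (Hex : forall x, exp x < R0 -> ex_RInt (fun y => snd (g (x, y))) 0 (2 * PI)).
  { intros x Hx. apply (ex_RInt_snd g x x 0 (2 * PI)); try lra.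
    intros u v Hu Hv. replace u with x by lra. now apply cdiff_ccont, Hg. }
  assert (Hconst : forall x1 x2, x1 <= x2 -> exp x2 < R0 -> I x1 = I x2).
  { intros x1 x2 H1 H2.
    assert (H3 : forall x, x <= x2 -> exp x < R0).
    { intros x Hx. destruct Hx as [Hx| ->]; [|exact H2]. apply exp_increasing in Hx. lra. }
    assert (G := goursat g x1 x2 0 (2 * PI) H1 ltac:(lra) ltac:(intros x y Hx Hy; apply Hg, H3; lra)).
    unfold boundary_int in G.
    rewrite (RInt_ext _ (fun _ => 0)) in G.
    2:{ intros x _. unfold g, cexp; simpl. rewrite sin_2PI, cos_2PI, sin_0, cos_0. ring. }
    rewrite RInt_const, RInt_minus_R in G by (apply Hex, H3; lra).
    unfold I, scal in *; simpl in G; unfold mult in G; simpl in G. lra. }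
  assert (Hs : exp (ln r) = r) by (apply exp_ln; lra).
  assert (HI : I (ln r) = 2 * PI * snd (h z0)).
  { apply cond_eq. intros e He.
    destruct (Hc (e / (4 * PI))) as [d [D Hd']]; [apply Rdiv_lt_0_compat; lra|].
    set (x := Rmin (ln r) (ln (d / 2))).
    assert (Hx1 : exp x <= r).
    { destruct (Rmin_l (ln r) (ln (d/2))) as [L|L]; fold x in L.
      - apply exp_increasing in L. lra.
      - rewrite L, Hs. lra. }
    assert (Hx2 : exp x <= d / 2).
    { assert (Hd2 : exp (ln (d/2)) = d/2) by (apply exp_ln; lra).
      destruct (Rmin_r (ln r) (ln (d/2))) as [L|L]; fold x in L.
      - apply exp_increasing in L. lra.
      - rewrite L, Hd2. lra. }
    rewrite <- (Hconst x (ln r)) by (try apply Rmin_l; lra).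
    assert (B := RInt_near_const (fun y => snd (g (x, y))) 0 (2 * PI) (snd (h z0)) (e / (4 * PI))
      ltac:(lra) (Hex x ltac:(lra))).
    fold (I x) in B. rewrite Rminus_0_r in B.
    replace (e / (4 * PI) * (2 * PI)) with (e / 2) in B by (field; lra).
    rewrite (Rmult_comm (snd (h z0))) in B.
    eapply Rle_lt_trans; [apply B|lra]. intros y _.
    apply Rabs_components_le, Rlt_le, Hd'.
    replace (z0 + cexp (x, y) - z0)%C with (cexp (x, y)) by ring.
    rewrite Cmod_cexp. simpl. lra. }
  rewrite <- HI.
  apply is_RInt_ext with (f := fun y => snd (g (ln r, y))).
  - intros y _. unfold g, circle_pt, cexp; simpl fst; simpl snd. now rewrite Hs.
  - apply (@RInt_correct R_CompleteNormedModule), Hex. lra.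
Qed.

(** * The maximum principle *)

(** Bisection applied to the property that every value of [phi] on the disk is
    dominated by a value on the part of the disk in the rectangle. *)
Lemma disk_max (phi : C -> R) (r : R) : 0 <= r ->
  (forall z, Cmod z <= r -> forall e, 0 < e -> exists d, 0 < d /\
     forall w, Cmod w <= r -> Cmod (w - z)%C < d -> Rabs (phi w - phi z) < e) ->
  exists z0, Cmod z0 <= r /\ forall z, Cmod z <= r -> phi z <= phi z0.
Proof.
  intros Hr Hphi.
  set (in_rect := fun (a b c d : R) (z : C) => a <= fst z <= b /\ c <= snd z <= d).
  destruct (rectangle_bisection (fun a b c d => forall z, Cmod z <= r ->
     exists z', Cmod z' <= r /\ in_rect a b c d z' /\ phi z <= phi z') (-r) r (-r) r)
    as (x & y & Hx & Hy & H).
  - lra.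
  - lra.
  - intros z Hz. exists z. split; [exact Hz|]. split; [|lra].
    split; apply Rabs_le_between;
      (eapply Rle_trans; [first [apply Cmod_fst|apply Cmod_snd]|exact Hz]).
  - intros a b c d G1 G2 G3 G4 G5 G6 P. apply NNPP. intros Q.
    apply not_or_and in Q. destruct Q as [Q1 Q].
    apply not_or_and in Q. destruct Q as [Q2 Q].
    apply not_or_and in Q. destruct Q as [Q3 Q4].
    assert (T : forall a b c d, ~ (forall z, Cmod z <= r ->
       exists z', Cmod z' <= r /\ in_rect a b c d z' /\ phi z <= phi z') ->
       exists z, Cmod z <= r /\ forall z', Cmod z' <= r -> in_rect a b c d z' -> phi z' < phi z).
    { intros a1 b1 c1 d1 N. apply not_all_ex_not in N. destruct N as [z N].
      apply imply_to_and in N. destruct N as [N1 N2]. exists z. split; [exact N1|].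
      intros z' H1 H2. apply Rnot_le_lt. intros L. apply N2. eauto. }
    apply T in Q1, Q2, Q3, Q4.
    destruct Q1 as [z1 [Z1 Q1]], Q2 as [z2 [Z2 Q2]], Q3 as [z3 [Z3 Q3]], Q4 as [z4 [Z4 Q4]].
    assert (M : forall u v : C, Cmod u <= r -> Cmod v <= r -> exists w, Cmod w <= r /\ phi u <= phi w /\ phi v <= phi w).
    { intros u v Hu Hv. destruct (Rle_lt_dec (phi u) (phi v)); [exists v|exists u]; repeat split; trivial; lra. }
    destruct (M z1 z2 Z1 Z2) as (u & U & U1 & U2).
    destruct (M z3 z4 Z3 Z4) as (v & V & V1 & V2).
    destruct (M u v U V) as (w & W & W1 & W2).
    destruct (P w W) as (z & Z & [I1 I2] & L).
    destruct (Rle_lt_dec (fst z) ((a+b)/2)) as [X|X]; destruct (Rle_lt_dec (snd z) ((c+d)/2)) as [Y|Y].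
    + specialize (Q1 z Z). unfold in_rect in Q1. lra.
    + specialize (Q3 z Z). unfold in_rect in Q3. lra.
    + specialize (Q2 z Z). unfold in_rect in Q2. lra.
    + specialize (Q4 z Z). unfold in_rect in Q4. lra.
  - assert (Near : forall e, 0 < e -> forall z, Cmod z <= r ->
       exists z', Cmod z' <= r /\ Cmod (z' - (x, y))%C < e /\ phi z <= phi z').
    { intros e He z Hz. destruct (H (e/2)) as (a & b & c & d & P & A1 & A2 & A3 & A4 & A5 & A6); [lra|].
      destruct (P z Hz) as (z' & Z' & [I1 I2] & L). exists z'. repeat split; trivial.
      eapply Rle_lt_trans; [apply Cmod_le_abs|]. simpl.
      assert (Rabs (fst z' + - x) < e/2) by (apply Rabs_def1; lra).
      assert (Rabs (snd z' + - y) < e/2) by (apply Rabs_def1; lra). lra. }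
    assert (Hin : Cmod (x, y) <= r).
    { apply le_epsilon. intros e He.
      destruct (Near e He 0%C) as (z' & Z' & D & _); [now rewrite Cmod_0|].
      generalize (Cmod_le_add_sub (x, y) z'). rewrite Cmod_sub_sym. lra. }
    exists (x, y). split; [exact Hin|]. intros z Hz.
    apply le_epsilon. intros e He. destruct (Hphi _ Hin e He) as (d & D & Hd).
    destruct (Near d D z Hz) as (z' & Z' & D' & L).
    specialize (Hd z' Z' D'). apply Rabs_lt_between in Hd. lra.
Qed.

(** By the theorem on removable singularities this is holomorphy in the unit
    disk; this form holds for difference quotients by construction. *)
Definition nearly_holo (h : C -> C) : Prop :=
  forall z, Cmod z < 1 -> ccont h z /\
    exists d, 0 < d /\ forall w, w <> z -> Cmod (w - z)%C < d -> cdiff h w.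

Lemma RInt_circle_sq (z0 : C) (rho : R) :
  is_RInt (fun t => Cmod (circle_pt z0 rho t) ^ 2) 0 (2 * PI) (2 * PI * (Cmod z0 ^ 2 + rho ^ 2)).
Proof.
  assert (E : forall t, Cmod (circle_pt z0 rho t) ^ 2 =
    (Cmod z0 ^ 2 + rho ^ 2) + 2 * rho * (fst z0 * cos t + snd z0 * sin t)).
  { intros t. rewrite !Cmod_sq. unfold circle_pt; simpl.
    generalize (sin2_cos2 t). unfold Rsqr. intros T.
    replace (rho * (rho * 1)) with (rho * rho * (sin t * sin t + cos t * cos t)) by (rewrite T; ring). ring. }
  set (A := Cmod z0 ^ 2 + rho ^ 2) in *.
  set (F := fun t => A * t + 2 * rho * (fst z0 * sin t - snd z0 * cos t)).
  replace (2 * PI * A) with (minus (F (2 * PI)) (F 0)).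
  - apply (@is_RInt_derive R_CompleteNormedModule).
    + intros t _. rewrite E. unfold F. auto_derive; [trivial|ring].
    + intros t _. apply continuous_ext with (f := fun t => A + 2 * rho * (fst z0 * cos t + snd z0 * sin t)).
      { intros; now rewrite E. }
      apply (@ex_derive_continuous R_AbsRing R_NormedModule). auto_derive. trivial.
  - unfold F, minus, plus, opp; simpl. rewrite sin_2PI, cos_2PI, sin_0, cos_0. ring.
Qed.

(** The function [Cmod (h z) + eps * Cmod z ^ 2] attains its maximum over the
    disk of radius [r], and this cannot happen inside: there the mean of
    [Cmod h] over a small circle is at least its value at the center, and the
    mean of [Cmod z ^ 2] is strictly larger. *)
Lemma max_principle (h : C -> C) (r B : R) : 0 <= r < 1 -> nearly_holo h ->
  (forall z, Cmod z = r -> Cmod (h z) <= B) -> forall z, Cmod z <= r -> Cmod (h z) <= B.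
Proof.
  intros Hr Hh HB.
  cut (forall eps, 0 < eps -> forall z, Cmod z <= r -> Cmod (h z) <= B + eps * r ^ 2).
  { intros K z Hz. apply le_epsilon. intros e He.
    apply Rle_trans with (B + e * r ^ 2); [now apply K|]. assert (r ^ 2 <= 1) by nra. nra. }
  intros eps Heps.
  set (phi := fun z => Cmod (h z) + eps * Cmod z ^ 2).
  destruct (disk_max phi r) as [z0 [Hz0 Hmax]]; [lra| |].
  { intros z Hz e He. destruct (Hh z ltac:(lra)) as [Hc _].
    destruct (Hc (e/2)) as (d & D & Hd); [lra|].
    exists (Rmin d (e/(4*eps))). split; [apply Rmin_pos; [exact D|apply Rdiv_lt_0_compat; lra]|].
    intros w Hw Hwz.
    specialize (Hd w (Rlt_le_trans _ _ _ Hwz (Rmin_l _ _))).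
    assert (H2 := Rlt_le_trans _ _ _ Hwz (Rmin_r _ _)).
    apply Rmult_lt_compat_l with (r := 4 * eps) in H2; [|lra].
    replace (4 * eps * (e / (4 * eps))) with e in H2 by (field; lra).
    unfold phi.
    assert (A1 := Cmod_le_add_sub (h w) (h z)). assert (A2 := Cmod_le_add_sub (h z) (h w)).
    rewrite (Cmod_sub_sym (h z)) in A2.
    assert (A3 := Cmod_le_add_sub w z). assert (A4 := Cmod_le_add_sub z w).
    rewrite (Cmod_sub_sym z) in A4.
    assert (P1 := Cmod_ge_0 z). assert (P2 := Cmod_ge_0 w). assert (P3 := Cmod_ge_0 (w - z)%C).
    assert (A5 : Rabs (eps * Cmod w ^ 2 - eps * Cmod z ^ 2) <= 2 * eps * Cmod (w - z)%C).
    { replace (eps * Cmod w ^ 2 - eps * Cmod z ^ 2) with (eps * ((Cmod w + Cmod z) * (Cmod w - Cmod z))) by ring.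
      rewrite Rabs_mult, (Rabs_pos_eq eps), Rabs_mult, (Rabs_pos_eq (_ + _)) by lra.
      assert (Rabs (Cmod w - Cmod z) <= Cmod (w - z)%C) by (apply Rabs_le; lra).
      rewrite (Rmult_comm 2), Rmult_assoc. apply Rmult_le_compat_l; [lra|].
      apply Rmult_le_compat; try lra. apply Rabs_pos. }
    apply Rabs_le_between in A5. apply Rabs_def1; lra. }
  destruct (Rle_lt_dec r (Cmod z0)) as [L|L].
  { intros z Hz. specialize (Hmax z Hz). unfold phi in Hmax.
    assert (E : Cmod z0 = r) by lra. specialize (HB z0 E). rewrite E in Hmax.
    assert (0 <= eps * Cmod z ^ 2) by (apply Rmult_le_pos; [lra|apply pow2_ge_0]). lra. }
  exfalso.
  destruct (Hh z0 ltac:(lra)) as [Hc (d & D & Hd)].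
  set (rho := Rmin (d/2) (r - Cmod z0)).
  assert (Hrho : 0 < rho) by (apply Rmin_pos; lra).
  assert (Hrho1 : rho <= d/2) by apply Rmin_l.
  assert (Hrho2 : rho <= r - Cmod z0) by apply Rmin_r.
  (* The mean value property is available for imaginary parts: rotate [h] so
     that the imaginary part at [z0] is the modulus *)
  assert (Hlam : exists lam : C, Cmod lam = 1 /\ snd (lam * h z0)%C = Cmod (h z0)).
  { destruct (classic (h z0 = 0%C)) as [Z|Z].
    - exists 1%C. rewrite Z. split; [apply Cmod_1|]. rewrite Cmod_0. simpl. ring.
    - assert (P := Cmod_pos_neq _ Z). exists (Ci * Cconj (h z0) / Cmod (h z0))%C. split.
      + rewrite Cmod_div by (apply RtoC_inj_neq; lra). rewrite Cmod_mult, Cmod_Ci, Cmod_conj, Cmod_R.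
        rewrite Rabs_pos_eq by lra. field. lra.
      + replace (Ci * Cconj (h z0) / Cmod (h z0) * h z0)%C with (Ci * ((h z0 * Cconj (h z0)) / Cmod (h z0)))%C
          by (field; apply RtoC_inj_neq; lra).
        rewrite <- Cmod2_conj, <- RtoC_div by lra. simpl. field. lra. }
  destruct Hlam as (lam & Hlam1 & Hlam2).
  assert (MV := mean_value (fun z => lam * h z)%C z0 d rho ltac:(lra)
    ltac:(apply ccont_mult; [apply ccont_const|exact Hc])
    ltac:(intros z Hz1 Hz2; apply cdiff_mult; [apply cdiff_const|now apply Hd])).
  assert (SQ := RInt_circle_sq z0 rho).
  assert (Hpi := PI_RGT_0).
  set (m := phi z0).
  assert (Int2 : is_RInt (fun t => m - eps * Cmod (circle_pt z0 rho t) ^ 2) 0 (2 * PI)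
     ((2 * PI - 0) * m - eps * (2 * PI * (Cmod z0 ^ 2 + rho ^ 2)))).
  { apply (@is_RInt_minus R_NormedModule).
    - apply (@is_RInt_const R_NormedModule).
    - apply (@is_RInt_scal R_NormedModule). exact SQ. }
  assert (Le := is_RInt_le _ _ 0 (2 * PI) _ _ ltac:(lra) MV Int2).
  assert (Hpt : forall t, 0 < t < 2 * PI ->
    snd (lam * h (circle_pt z0 rho t))%C <= m - eps * Cmod (circle_pt z0 rho t) ^ 2).
  { intros t _. set (w := circle_pt z0 rho t).
    assert (Hw : Cmod w <= r).
    { generalize (Cmod_le_add_sub w z0). unfold w. rewrite Cmod_circle by lra. lra. }
    specialize (Hmax w Hw). unfold m. unfold phi in Hmax at 1.
    assert (A := Cmod_snd (lam * h w)%C). rewrite Cmod_mult, Hlam1 in A.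
    generalize (Rle_abs (snd (lam * h w)%C)). lra. }
  specialize (Le Hpt). cbv beta in Le. rewrite Hlam2 in Le. unfold m, phi in Le.
  assert (0 < 2 * PI * (eps * rho ^ 2)).
  { apply Rmult_lt_0_compat; [lra|]. apply Rmult_lt_0_compat; [lra|]. apply pow_lt; lra. }
  lra.
Qed.

(** * Involutive automorphisms of the disk *)

Definition mobius (p z : C) : C := ((p - z) / (1 - Cconj p * z))%C.

Lemma mobius_den_bounds (p z : C) : Cmod z <= 1 ->
  1 - Cmod p <= Cmod (1 - Cconj p * z)%C <= 1 + Cmod p.
Proof.
  intros Hz. assert (Hp := Cmod_ge_0 p). assert (Hz0 := Cmod_ge_0 z).
  assert (E : Cmod (Cconj p * z)%C <= Cmod p) by (rewrite Cmod_mult, Cmod_conj; nra).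
  assert (A := Cmod_le_add_sub 1%C (Cconj p * z)%C).
  assert (B := Cmod_sub_le 1%C (Cconj p * z)%C).
  rewrite Cmod_1 in *. lra.
Qed.

Lemma mobius_den_neq0 (p z : C) : Cmod p < 1 -> Cmod z <= 1 -> (1 - Cconj p * z)%C <> 0%C.
Proof.
  intros Hp Hz. apply Cmod_gt_0. generalize (mobius_den_bounds p z Hz). lra.
Qed.

(** The identity that shows that [mobius p] preserves the disk; it measures how
    far [mobius p z] is from the unit circle. *)
Lemma mobius_sq (p z : C) : Cmod p < 1 -> Cmod z <= 1 ->
  (1 - Cmod (mobius p z) ^ 2) * Cmod (1 - Cconj p * z)%C ^ 2 = (1 - Cmod p ^ 2) * (1 - Cmod z ^ 2).
Proof.
  intros Hp Hz. assert (N := mobius_den_neq0 p z Hp Hz). assert (P := Cmod_pos_neq _ N).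
  unfold mobius. rewrite Cmod_div by exact N.
  replace ((1 - (Cmod (p - z) / Cmod (1 - Cconj p * z)) ^ 2) * Cmod (1 - Cconj p * z) ^ 2)
    with (Cmod (1 - Cconj p * z)%C ^ 2 - Cmod (p - z)%C ^ 2) by (field; lra).
  rewrite !Cmod_sq. simpl. ring.
Qed.

Lemma mobius_le1 (p z : C) : Cmod p < 1 -> Cmod z <= 1 -> Cmod (mobius p z) <= 1.
Proof.
  intros Hp Hz. assert (E := mobius_sq p z Hp Hz).
  assert (P := Cmod_pos_neq _ (mobius_den_neq0 p z Hp Hz)).
  assert (P2 : 0 < Cmod (1 - Cconj p * z)%C ^ 2) by (apply pow_lt, P).
  generalize (Cmod_ge_0 p) (Cmod_ge_0 z). intros.
  assert (0 <= (1 - Cmod p ^ 2) * (1 - Cmod z ^ 2)) by (apply Rmult_le_pos; nra).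
  apply sq_le_sq; [lra|]. nra.
Qed.

Lemma mobius_lt1 (p z : C) : Cmod p < 1 -> Cmod z < 1 -> Cmod (mobius p z) < 1.
Proof.
  intros Hp Hz. assert (E := mobius_sq p z Hp ltac:(lra)).
  assert (P := Cmod_pos_neq _ (mobius_den_neq0 p z Hp ltac:(lra))).
  assert (P2 : 0 < Cmod (1 - Cconj p * z)%C ^ 2) by (apply pow_lt, P).
  generalize (Cmod_ge_0 p) (Cmod_ge_0 z). intros.
  assert (0 < (1 - Cmod p ^ 2) * (1 - Cmod z ^ 2)) by (apply Rmult_lt_0_compat; nra).
  assert (0 < 1 - Cmod (mobius p z) ^ 2) by nra. nra.
Qed.

Lemma mobius_0 (p : C) : mobius p 0 = p.
Proof. unfold mobius. field. Qed.

Lemma mobius_self (p : C) : mobius p p = 0%C.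
Proof. unfold mobius, Cdiv. replace (p - p)%C with (RtoC 0) by ring. ring. Qed.

Lemma mobius_at_0 (z : C) : mobius 0 z = (- z)%C.
Proof.
  unfold mobius. replace (Cconj 0) with (RtoC 0).
  - field.
  - unfold Cconj, RtoC; simpl. f_equal; ring.
Qed.

Lemma mobius_involutive (p z : C) : Cmod p < 1 -> Cmod z < 1 -> mobius p (mobius p z) = z.
Proof.
  intros Hp Hz. assert (N := mobius_den_neq0 p z Hp ltac:(lra)).
  assert (M := mobius_den_neq0 p (mobius p z) Hp (mobius_le1 p z Hp ltac:(lra))).
  assert (K := mobius_den_neq0 p p Hp ltac:(lra)).
  unfold mobius in *. field. repeat split; try exact N.
  intros E. apply M.
  replace (1 - Cconj p * ((p - z) / (1 - Cconj p * z)))%C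
    with ((1 - Cconj p * z - Cconj p * (p - z)) / (1 - Cconj p * z))%C by (field; exact N).
  rewrite E. field. exact N.
Qed.

Lemma cdiff_div (f g : C -> C) (z : C) : cdiff f z -> cdiff g z -> g z <> 0%C ->
  cdiff (fun w => f w / g w)%C z.
Proof. intros. apply cdiff_mult; [assumption|now apply cdiff_inv]. Qed.

Lemma cdiff_mobius (p z : C) : Cmod p < 1 -> Cmod z <= 1 -> cdiff (mobius p) z.
Proof.
  intros Hp Hz. apply cdiff_div.
  - apply cdiff_minus; [apply cdiff_const|apply cdiff_id].
  - apply cdiff_minus; [apply cdiff_const|apply cdiff_mult; [apply cdiff_const|apply cdiff_id]].
  - now apply mobius_den_neq0.
Qed.

Lemma Cmod_sub_le_mobius (a b : C) : Cmod a < 1 -> Cmod b < 1 ->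
  Cmod (a - b)%C <= 2 * Cmod (mobius a b).
Proof.
  intros Ha Hb. assert (N := mobius_den_neq0 a b Ha ltac:(lra)).
  assert (P := Cmod_pos_neq _ N).
  unfold mobius. rewrite Cmod_div by exact N.
  generalize (mobius_den_bounds a b ltac:(lra)) (Cmod_ge_0 (a - b)%C). intros B Q.
  apply Rmult_le_reg_r with (Cmod (1 - Cconj a * b)%C); [exact P|].
  replace (2 * (Cmod (a - b) / Cmod (1 - Cconj a * b)) * Cmod (1 - Cconj a * b))
    with (2 * Cmod (a - b)%C) by (field; lra). nra.
Qed.

Lemma mobius_le_sub (a b : C) (r : R) : Cmod a <= r -> Cmod b <= 1 -> r < 1 ->
  Cmod (mobius a b) <= Cmod (a - b)%C / (1 - r).
Proof.
  intros Ha Hb Hr. assert (N := mobius_den_neq0 a b ltac:(lra) Hb).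
  assert (P := Cmod_pos_neq _ N).
  unfold mobius. rewrite Cmod_div by exact N.
  generalize (mobius_den_bounds a b ltac:(lra)). intros B.
  apply Rmult_le_compat_l; [apply Cmod_ge_0|]. apply Rinv_le_contravar; lra.
Qed.

(** * The Schwarz and Schwarz-Pick lemmas *)

Lemma nearly_holo_map (h k : C -> C) :
  (forall z, Cmod z < 1 -> ccont h z -> ccont k z) ->
  (forall z, Cmod z < 1 -> cdiff h z -> cdiff k z) ->
  nearly_holo h -> nearly_holo k.
Proof.
  intros Hc Hd H z Hz. destruct (H z Hz) as [A (d & D & B)]. split; [auto|].
  exists (Rmin d (1 - Cmod z)). split; [apply Rmin_pos; lra|].
  intros w Hw Hwz.
  assert (H1 := Rlt_le_trans _ _ _ Hwz (Rmin_l _ _)).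
  assert (H2 := Rlt_le_trans _ _ _ Hwz (Rmin_r _ _)).
  apply Hd; [|now apply B]. generalize (Cmod_le_add_sub w z). lra.
Qed.

Lemma nearly_holo_of_cdiff (h : C -> C) : (forall z, Cmod z < 1 -> cdiff h z) -> nearly_holo h.
Proof.
  intros H. apply nearly_holo_map with (h := fun z => z); auto.
  - intros z Hz _. now apply cdiff_ccont, H.
  - intros z Hz. split; [apply ccont_id|]. exists 1. split; [lra|]. intros; apply cdiff_id.
Qed.

Lemma slope_off_base (g q : C -> C) (x z : C) : slope_at g q x -> z <> x ->
  exists d, 0 < d /\ forall w, Cmod (w - z)%C < d -> w <> x /\ ((g w - g x) / (w - x))%C = q w.
Proof.
  intros [_ E] Hz. exists (Cmod (z - x)%C). split; [now apply Cmod_sub_pos|].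
  intros w Hw. assert (w <> x).
  { intros ->. rewrite Cmod_sub_sym in Hw. lra. }
  split; [assumption|]. rewrite (E w) at 1. field. now apply Cminus_neq_0.
Qed.

Lemma cdiff_slope (g q : C -> C) (x z : C) : slope_at g q x -> z <> x -> cdiff g z -> cdiff q z.
Proof.
  intros Hs Hz Hg. destruct (slope_off_base g q x z Hs Hz) as (d & D & E).
  apply cdiff_ext_loc with (f := fun w => ((g w - g x) / (w - x))%C) (d := d); [exact D|apply E|].
  apply cdiff_div; [apply cdiff_minus; [exact Hg|apply cdiff_const]| |].
  - apply cdiff_minus; [apply cdiff_id|apply cdiff_const].
  - now apply Cminus_neq_0.
Qed.

Lemma ccont_slope (g q : C -> C) (x z : C) : slope_at g q x -> ccont g z -> ccont q z.
Proof.
  intros Hs Hg. destruct (classic (z = x)) as [->|Hz]; [apply Hs|].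
  destruct (slope_off_base g q x z Hs Hz) as (d & D & E).
  apply ccont_ext_loc with (f := fun w => ((g w - g x) / (w - x))%C) (d := d); [exact D|apply E|].
  apply ccont_mult; [apply ccont_minus; [exact Hg|apply ccont_const]|].
  apply ccont_inv; [apply ccont_minus; [apply ccont_id|apply ccont_const]|].
  now apply Cminus_neq_0.
Qed.

Lemma nearly_holo_slope (g q : C -> C) (x : C) :
  nearly_holo g -> slope_at g q x -> nearly_holo q.
Proof.
  intros Hg Hs z Hz. destruct (Hg z Hz) as [A (d & D & B)].
  split; [now apply ccont_slope with g x|].
  destruct (classic (z = x)) as [->|N].
  - exists d. split; [exact D|]. intros w Hw Hwx. apply cdiff_slope with g x; auto.
  - destruct (slope_off_base g q x z Hs N) as (d' & D' & E).
    exists (Rmin d d'). split; [now apply Rmin_pos|]. intros w Hw Hwz.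
    assert (H1 := Rlt_le_trans _ _ _ Hwz (Rmin_l _ _)).
    assert (H2 := Rlt_le_trans _ _ _ Hwz (Rmin_r _ _)).
    apply cdiff_slope with g x; [exact Hs|now apply (E w)|now apply B].
Qed.

Lemma mobius_near_boundary (x w : C) (r : R) : Cmod x < 1 -> Cmod w = r -> 0 <= r < 1 ->
  1 - Cmod (mobius x w) ^ 2 <= (1 - r ^ 2) / (1 - Cmod x) ^ 2.
Proof.
  intros Hx Hw Hr. assert (E := mobius_sq x w Hx ltac:(lra)). rewrite Hw in E.
  assert (B := mobius_den_bounds x w ltac:(lra)).
  assert (0 <= 1 - r ^ 2) by nra.
  assert (P : 0 < (1 - Cmod x) ^ 2) by (apply pow_lt; lra).
  apply Rmult_le_reg_r with ((1 - Cmod x) ^ 2); [exact P|].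
  replace ((1 - r ^ 2) / (1 - Cmod x) ^ 2 * (1 - Cmod x) ^ 2) with (1 - r ^ 2) by (field; lra).
  assert (L := mobius_lt1 x w Hx ltac:(lra)). assert (L0 := Cmod_ge_0 (mobius x w)).
  assert (0 <= 1 - Cmod (mobius x w) ^ 2) by nra.
  assert (Q : (1 - Cmod x) ^ 2 <= Cmod (1 - Cconj x * w)%C ^ 2) by (apply pow_incr; lra).
  apply Rle_trans with ((1 - Cmod (mobius x w) ^ 2) * Cmod (1 - Cconj x * w)%C ^ 2).
  - now apply Rmult_le_compat_l.
  - rewrite E. generalize (Cmod_ge_0 x). intros. nra.
Qed.

(** The Schwarz lemma as a factorization: near the unit circle the modulus of
    [mobius x] tends to 1, so that the maximum principle bounds the quotient of
    [g] by [mobius x] by 1. *)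
Lemma schwarz_factor (g : C -> C) (x : C) :
  nearly_holo g -> (forall z, Cmod z < 1 -> Cmod (g z) <= 1) ->
  Cmod x < 1 -> g x = 0%C -> cdiff g x ->
  exists H, nearly_holo H /\ (forall z, Cmod z < 1 -> Cmod (H z) <= 1) /\
    (forall z, Cmod z < 1 -> g z = (mobius x z * H z)%C) /\
    (forall z, z <> x -> cdiff g z -> cdiff H z).
Proof.
  intros Hg Hg1 Hx Hgx [q Hq].
  set (H := fun z => (- q z * (1 - Cconj x * z))%C).
  assert (Dl : forall z, cdiff (fun z => (1 - Cconj x * z)%C) z).
  { intros z. apply cdiff_minus; [apply cdiff_const|apply cdiff_mult; [apply cdiff_const|apply cdiff_id]]. }
  assert (HH : nearly_holo H).
  { apply nearly_holo_map with q; [| |now apply nearly_holo_slope with g x].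
    - intros z _ A. apply ccont_mult; [now apply ccont_opp|apply cdiff_ccont, Dl].
    - intros z _ A. apply cdiff_mult; [|apply Dl].
      apply (cdiff_ext_loc (fun w => (0 - q w)%C)) with (d := 1); [lra|intros; ring|].
      apply cdiff_minus; [apply cdiff_const|exact A]. }
  assert (HE : forall z, Cmod z < 1 -> g z = (mobius x z * H z)%C).
  { intros z Hz. rewrite (proj2 Hq z), Hgx. unfold H, mobius. field.
    apply mobius_den_neq0; lra. }
  exists H. repeat split; trivial; [apply HH; assumption..| |].
  - intros z Hz. apply Rnot_lt_le. intros L.
    (* With 1 < B < |H z|, it suffices that |mobius x| >= 1 / B on a circle of
       radius r >= |z|, which holds for r close to 1 *)
    set (B := (1 + Cmod (H z)) / 2).
    assert (HB : 1 < B < Cmod (H z)) by (unfold B; lra).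
    set (eta := (1 - Cmod x) ^ 2 * (1 - / B ^ 2)).
    assert (Bi : / B ^ 2 < 1).
    { rewrite <- Rinv_1. apply Rinv_lt_contravar; nra. }
    assert (He : 0 < eta) by (apply Rmult_lt_0_compat; [apply pow_lt|]; lra).
    set (r := Rmax (Cmod z) (1 - eta / 4)).
    assert (R1 : Cmod z <= r) by apply Rmax_l.
    assert (R2 : 1 - eta / 4 <= r) by apply Rmax_r.
    assert (R3 : r < 1) by (apply Rmax_lub_lt; lra).
    assert (R4 := Cmod_ge_0 z).
    assert (M := max_principle H r B ltac:(lra) HH).
    cut (Cmod (H z) <= B); [lra|]. apply M; [|exact R1].
    intros w Hw. apply sq_le_sq; [lra|].
    assert (N := mobius_near_boundary x w r Hx Hw ltac:(lra)).
    assert (N2 : (1 - r ^ 2) / (1 - Cmod x) ^ 2 <= 1 - / B ^ 2).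
    { apply Rmult_le_reg_r with ((1 - Cmod x) ^ 2); [apply pow_lt; lra|].
      replace ((1 - r ^ 2) / (1 - Cmod x) ^ 2 * (1 - Cmod x) ^ 2) with (1 - r ^ 2) by (field; lra).
      rewrite Rmult_comm. fold eta. nra. }
    assert (G := Hg1 w ltac:(lra)). rewrite HE in G by lra. rewrite Cmod_mult in G.
    set (m := Cmod (mobius x w)) in *. assert (m0 : 0 <= m) by apply Cmod_ge_0.
    set (y := Cmod (H w)) in *. assert (y0 : 0 <= y) by apply Cmod_ge_0.
    assert (my : (m * y) ^ 2 <= 1) by (assert (0 <= m * y) by (apply Rmult_le_pos; lra); generalize dependent (m * y); intros; nra).
    assert (mB : / B ^ 2 <= m ^ 2) by lra.
    assert (PB : 0 < B ^ 2) by (apply pow_lt; lra).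
    apply Rmult_le_reg_l with (/ B ^ 2); [now apply Rinv_0_lt_compat|].
    rewrite Rinv_l by lra.
    apply Rle_trans with (m ^ 2 * y ^ 2); [apply Rmult_le_compat_r; [apply pow2_ge_0|exact mB]|].
    rewrite <- Rpow_mult_distr. exact my.
  - intros z Hz A. apply cdiff_mult; [|apply Dl].
    apply (cdiff_ext_loc (fun w => (0 - q w)%C)) with (d := 1); [lra|intros; ring|].
    apply cdiff_minus; [apply cdiff_const|now apply cdiff_slope with g x].
Qed.

Lemma schwarz_pick (h : C -> C) (x z : C) :
  nearly_holo h -> (forall z, Cmod z < 1 -> Cmod (h z) < 1) ->
  Cmod x < 1 -> cdiff h x -> Cmod z < 1 ->
  Cmod (mobius (h x) (h z)) <= Cmod (mobius x z).
Proof.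
  intros Hh Hh1 Hx Hd Hz.
  assert (Hm : forall w, Cmod w < 1 -> cdiff (mobius (h x)) (h w)).
  { intros w Hw. apply cdiff_mobius; [now apply Hh1|apply Rlt_le; now apply Hh1]. }
  destruct (schwarz_factor (fun w => mobius (h x) (h w)) x) as (H & _ & H1 & HE & _); trivial.
  - apply nearly_holo_map with h; trivial.
    + intros w Hw A. apply ccont_comp; [exact A|]. now apply cdiff_ccont, Hm.
    + intros w Hw A. apply cdiff_comp; [exact A|]. now apply Hm.
  - intros w Hw. apply Rlt_le, mobius_lt1; now apply Hh1.
  - apply mobius_self.
  - apply (cdiff_comp (mobius (h x)) h); auto.
  - rewrite HE by exact Hz. rewrite Cmod_mult.
    generalize (H1 z Hz) (Cmod_ge_0 (mobius x z)). nra.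
Qed.

(** * Comparison with the Poincare distance *)

Lemma ccont_conj (f : C -> C) (z : C) : ccont f z -> ccont (fun w => Cconj (f w)) z.
Proof.
  intros H e He. destruct (H e He) as (d & D & Hd). exists d. split; [exact D|].
  intros w Hw. specialize (Hd w Hw). rewrite <- Cmod_conj in Hd.
  replace (Cconj (f w) - Cconj (f z))%C with (Cconj (f w - f z)); [exact Hd|].
  unfold Cconj, Cminus, Cplus, Copp; simpl. f_equal; ring.
Qed.

Lemma RtoC_dist (s t : R) : Cmod (RtoC s - RtoC t)%C = Rabs (s - t).
Proof. rewrite <- RtoC_minus. apply Cmod_R. Qed.

Lemma continuous_Cmod_real_axis (f : C -> C) (t : R) : ccont f (RtoC t) ->
  continuous (fun s => Cmod (f (RtoC s))) t.
Proof.
  intros H. apply continuous_eps. intros e He. destruct (H e He) as (d & D & Hd).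
  exists d. split; [exact D|]. intros s Hs. rewrite <- RtoC_dist in Hs. specialize (Hd _ Hs).
  generalize (Cmod_le_add_sub (f (RtoC s)) (f (RtoC t))) (Cmod_le_add_sub (f (RtoC t)) (f (RtoC s))).
  rewrite (Cmod_sub_sym (f (RtoC t))). intros. apply Rabs_def1; lra.
Qed.

Lemma continuous_fst_real_axis (f : C -> C) (t : R) : ccont f (RtoC t) ->
  continuous (fun s => fst (f (RtoC s))) t.
Proof.
  intros H. apply (continuous_path f RtoC t H). intros s. rewrite RtoC_dist. lra.
Qed.

Lemma continuous_real_axis (f : C -> C) (t : R) : ccont f (RtoC t) ->
  @continuous R_UniformSpace C_UniformSpace (fun s => f (RtoC s)) t.
Proof.
  intros H. apply filterlim_locally. intros eps.
  destruct (H eps (cond_pos eps)) as (d & D & Hd). exists (mkposreal d D).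
  intros s Hs. assert (Hs' : Rabs (s - t) < d) by exact Hs. rewrite <- RtoC_dist in Hs'.
  specialize (Hd _ Hs'). split.
  - eapply Rle_lt_trans; [apply (Cmod_fst (f (RtoC s) - f (RtoC t))%C)|exact Hd].
  - eapply Rle_lt_trans; [apply (Cmod_snd (f (RtoC s) - f (RtoC t))%C)|exact Hd].
Qed.

Lemma ccont_of_path (g : R -> C) (t : R) :
  @continuous R_UniformSpace C_UniformSpace g t -> ccont (fun u => g (fst u)) (RtoC t).
Proof.
  intros H eps He.
  destruct (proj1 (filterlim_locally _ _) H (mkposreal (eps / 2) ltac:(lra))) as [d Hd].
  exists d. split; [apply cond_pos|]. intros w Hw.
  destruct (Hd (fst w)) as [H1 H2].
  { eapply Rle_lt_trans; [apply (Cmod_fst (w - RtoC t)%C)|exact Hw]. }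
  eapply Rle_lt_trans; [apply Cmod_le_abs|].
  change (Rabs (fst (g (fst w)) - fst (g t)) < eps / 2) in H1.
  change (Rabs (snd (g (fst w)) - snd (g t)) < eps / 2) in H2.
  change (Rabs (fst (g (fst w)) - fst (g t)) + Rabs (snd (g (fst w)) - snd (g t)) < eps). lra.
Qed.

(** Paths are built as restrictions to the real axis of functions of a complex
    variable, so that their continuity and derivatives come from the complex
    calculus. *)
Lemma is_derive_real_axis (G K : C -> C) (t d : R) : 0 < d -> ccont K (RtoC t) ->
  (forall u, Cmod (u - RtoC t)%C < d -> G u = (G (RtoC t) + K u * (u - RtoC t))%C) ->
  @is_derive R_AbsRing C_R_NormedModule (fun s => G (RtoC s)) t (K (RtoC t)).
Proof.
  intros Hd HK HG. split; [apply is_linear_scal_l|].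
  intros x Hx. assert (t = x) as <- by (now apply is_filter_lim_locally_unique).
  intros eps. destruct (HK eps (cond_pos eps)) as (d' & D' & Hd').
  assert (HD : 0 < Rmin d d') by (now apply Rmin_pos).
  exists (mkposreal _ HD). intros s Hs.
  assert (Hs' : Rabs (s - t) < Rmin d d') by exact Hs. rewrite <- RtoC_dist in Hs'.
  assert (H1 := Rlt_le_trans _ _ _ Hs' (Rmin_l _ _)).
  assert (H2 := Rlt_le_trans _ _ _ Hs' (Rmin_r _ _)).
  set (v := (G (RtoC s) - G (RtoC t) - (RtoC s - RtoC t) * K (RtoC t))%C).
  assert (Ev : v = ((K (RtoC s) - K (RtoC t)) * (RtoC s - RtoC t))%C).
  { unfold v. rewrite (HG _ H1). ring. }
  assert (Bv : Cmod v <= eps * Rabs (s - t)).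
  { rewrite Ev, Cmod_mult, RtoC_dist. apply Rmult_le_compat_r; [apply Rabs_pos|].
    apply Rlt_le, Hd', H2. }
  change (norm (minus s t)) with (Rabs (s - t)).
  eapply Rle_trans; [|exact Bv]. apply Req_le.
  match goal with |- norm ?w = _ => replace w with v end.
  - unfold norm; simpl. unfold prod_norm, norm; simpl. unfold abs; simpl.
    unfold Cmod. rewrite <- (pow2_abs (fst v)), <- (pow2_abs (snd v)). simpl. reflexivity.
  - unfold v, minus, plus, opp, scal; simpl. unfold prod_plus, prod_opp, prod_scal, plus, opp, scal; simpl.
    unfold mult; simpl. unfold Cminus, Cplus, Copp, Cmult, RtoC; simpl.
    f_equal; ring.
Qed.

(** The path is the hyperbolic segment, the image under [mobius p] of a Euclidean
    segment ending at 0.  Its length is an inverse hyperbolic tangent, for which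
    a crude bound suffices. *)
Lemma mobius_geodesic (p z : C) : Cmod p < 1 -> Cmod z < 1 ->
  exists l, path_length z p l /\ l <= 1 / (1 - Cmod (mobius p z) ^ 2).
Proof.
  intros Hp Hz. set (a := mobius p z).
  assert (Ha : Cmod a < 1) by (now apply mobius_lt1).
  assert (Ha0 := Cmod_ge_0 a).
  set (w := fun u : C => ((1 - u) * a)%C).
  set (den := fun u : C => (1 - Cconj p * w u)%C).
  set (G := fun u => mobius p (w u)).
  set (k := (a * (1 - Cconj p * p))%C).
  assert (Wsmall : forall t, 0 <= t <= 1 -> Cmod (w (RtoC t)) = (1 - t) * Cmod a).
  { intros t Ht. unfold w. rewrite <- RtoC_minus, Cmod_mult, Cmod_R, Rabs_pos_eq; lra. }
  assert (Wle : forall t, 0 <= t <= 1 -> Cmod (w (RtoC t)) <= Cmod a).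
  { intros t Ht. rewrite Wsmall by exact Ht. nra. }
  assert (Cden : forall u, ccont den u).
  { intros u. unfold den, w. apply cdiff_ccont.
    apply cdiff_minus; [apply cdiff_const|].
    apply cdiff_mult; [apply cdiff_const|].
    apply cdiff_mult; [|apply cdiff_const].
    apply cdiff_minus; [apply cdiff_const|apply cdiff_id]. }
  assert (Nden : forall t, 0 <= t <= 1 -> den (RtoC t) <> 0%C).
  { intros t Ht. apply mobius_den_neq0; [exact Hp|]. generalize (Wle t Ht); lra. }
  assert (HC1 : C1_path_in_disk (fun s => G (RtoC s)) (fun s => (k / (den (RtoC s) * den (RtoC s)))%C)).
  { intros t Ht. assert (Nt := Nden t Ht). split; [|split].
    - apply mobius_lt1; [exact Hp|]. generalize (Wle t Ht); lra.
    - destruct (ccont_neq0 den (RtoC t) (Cden _) Nt) as (d & D & Hd).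
      apply (is_derive_real_axis G (fun u => (k / (den u * den (RtoC t)))%C) t d D).
      + apply ccont_mult; [apply ccont_const|]. apply ccont_inv; [|now apply Cmult_neq_0].
        apply ccont_mult; [apply Cden|apply ccont_const].
      + intros u Hu. specialize (Hd u Hu).
        assert (Nu : den u <> 0%C). { apply Cmod_gt_0. generalize (Cmod_ge_0 (den (RtoC t))); lra. }
        unfold G, mobius, k. fold (den u) (den (RtoC t)).
        replace (p - w u)%C with ((p - w (RtoC t)) * den u / den (RtoC t) + a * (1 - Cconj p * p) * (u - RtoC t) / den (RtoC t))%C.
        * field. auto.
        * apply Cmult_cancel_r with (den (RtoC t)); [exact Nt|].
          transitivity ((p - w (RtoC t)) * den u + a * (1 - Cconj p * p) * (u - RtoC t))%C; [field; exact Nt|].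
          unfold den, w. ring.
    - apply (continuous_real_axis (fun u => (k / (den u * den u))%C)).
      apply ccont_mult; [apply ccont_const|]. apply ccont_inv; [|now apply Cmult_neq_0].
      apply ccont_mult; apply Cden. }
  exists (C1_path_length (fun s => G (RtoC s)) (fun s => (k / (den (RtoC s) * den (RtoC s)))%C)). split.
  - assert (E0 : G (RtoC 0) = z).
    { unfold G, w. replace ((1 - 0) * a)%C with a by ring. now apply mobius_involutive. }
    assert (E1 : G (RtoC 1) = p).
    { unfold G, w. replace ((1 - 1) * a)%C with (RtoC 0) by ring. apply mobius_0. }
    assert (Q := path_length_C1 _ _ HC1). cbv beta in Q. rewrite E0, E1 in Q. exact Q.
  - unfold C1_path_length.
    rewrite (RInt_ext _ (fun t => Cmod a / (1 - ((1 - t) * Cmod a) ^ 2))).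
    2:{ intros t Ht. rewrite Rmin_left, Rmax_right in Ht by lra.
        assert (Nt := Nden t ltac:(lra)). assert (W := Wsmall t ltac:(lra)).
        assert (Wl := Wle t ltac:(lra)).
        assert (E := mobius_sq p (w (RtoC t)) Hp ltac:(lra)).
        fold (den (RtoC t)) (G (RtoC t)) in E.
        unfold poincare_density. rewrite Cmod_div by (now apply Cmult_neq_0).
        rewrite Cmod_mult. unfold k. rewrite Cmod_mult.
        replace (Cmod (1 - Cconj p * p)%C) with (1 - Cmod p ^ 2).
        2:{ rewrite Cmult_comm, <- Cmod2_conj, <- RtoC_minus, Cmod_R, Rabs_pos_eq; [reflexivity|].
            generalize (Cmod_ge_0 p); nra. }
        assert (P := Cmod_pos_neq _ Nt). rewrite <- W.
        assert (Gl : Cmod (G (RtoC t)) < 1) by (apply mobius_lt1; lra).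
        assert (Gl0 := Cmod_ge_0 (G (RtoC t))).
        assert (0 < 1 - Cmod (G (RtoC t)) ^ 2) by nra.
        assert (0 < 1 - Cmod (w (RtoC t)) ^ 2) by (generalize (Cmod_ge_0 (w (RtoC t))); nra).
        apply Rmult_eq_reg_r with ((1 - Cmod (G (RtoC t)) ^ 2) * Cmod (den (RtoC t)) ^ 2 * (1 - Cmod (w (RtoC t)) ^ 2)).
        2:{ apply Rgt_not_eq. repeat apply Rmult_lt_0_compat; try lra. }
        transitivity (Cmod a * (1 - Cmod p ^ 2) * (1 - Cmod (w (RtoC t)) ^ 2)); [field; lra|].
        rewrite E at 1. field. lra. }
    apply Rle_trans with (RInt (fun _ => 1 / (1 - Cmod a ^ 2)) 0 1).
    + assert (Pos : forall t, 0 <= t <= 1 -> 1 - Cmod a ^ 2 <= 1 - ((1 - t) * Cmod a) ^ 2).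
      { intros t Ht. assert (0 <= (1 - t) * Cmod a <= Cmod a) by nra. nra. }
      assert (0 < 1 - Cmod a ^ 2) by nra.
      apply RInt_le; [lra| |apply ex_RInt_const|].
      * apply (@ex_RInt_continuous R_CompleteNormedModule). intros t.
        rewrite Rmin_left, Rmax_right by lra. intros Ht. specialize (Pos t Ht).
        apply (@ex_derive_continuous R_AbsRing R_NormedModule). auto_derive. simpl in Pos. lra.
      * intros t Ht. specialize (Pos t ltac:(lra)).
        apply Rle_trans with (1 / (1 - ((1 - t) * Cmod a) ^ 2)).
        -- apply Rmult_le_compat_r; [|lra]. apply Rlt_le, Rinv_0_lt_compat. lra.
        -- apply Rmult_le_compat_l; [lra|]. apply Rinv_le_contravar; lra.
    + rewrite RInt_const. unfold scal; simpl; unfold mult; simpl. lra.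
Qed.

(** Up to a constant depending on [p], the logarithm of
    [1 - Cmod (mobius p z) ^ 2]; unlike the hyperbolic distance to [p] it is
    smooth at [p]. *)
Definition log_gauge (p z : C) : R := ln (1 - Cmod z ^ 2) - ln (Cmod (1 - Cconj p * z)%C ^ 2).

Lemma exp_log_gauge (p z : C) : Cmod p < 1 -> Cmod z < 1 ->
  1 - Cmod (mobius p z) ^ 2 = exp (log_gauge p z - log_gauge p p).
Proof.
  intros Hp Hz. assert (P := Cmod_pos_neq _ (mobius_den_neq0 p z Hp ltac:(lra))).
  assert (P2 : 0 < Cmod (1 - Cconj p * z)%C ^ 2) by (apply pow_lt, P).
  assert (E := mobius_sq p z Hp ltac:(lra)).
  assert (Ep : Cmod (1 - Cconj p * p)%C = 1 - Cmod p ^ 2).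
  { rewrite Cmult_comm, <- Cmod2_conj, <- RtoC_minus, Cmod_R, Rabs_pos_eq; [reflexivity|].
    generalize (Cmod_ge_0 p); nra. }
  assert (Pp : 0 < 1 - Cmod p ^ 2) by (generalize (Cmod_ge_0 p); nra).
  assert (Pz : 0 < 1 - Cmod z ^ 2) by (generalize (Cmod_ge_0 z); nra).
  unfold log_gauge. rewrite Ep.
  rewrite <- (ln_div (1 - Cmod p ^ 2)) by (try apply pow_lt; lra).
  rewrite <- ln_div by lra.
  rewrite <- ln_div by (try apply Rdiv_lt_0_compat; try apply pow_lt; lra).
  rewrite exp_ln by (repeat apply Rdiv_lt_0_compat; try apply pow_lt; lra).
  apply Rmult_eq_reg_r with (Cmod (1 - Cconj p * z)%C ^ 2); [|lra].
  rewrite E. field. lra.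
Qed.

Lemma is_derive_fst (g : R -> C) (t : R) (l : C) :
  @is_derive R_AbsRing C_R_NormedModule g t l -> is_derive (fun s => fst (g s)) t (fst l).
Proof.
  intros H. unfold is_derive in *.
  apply filterdiff_ext_lin with (l1 := fun y => fst (@scal R_AbsRing C_R_NormedModule y l)); [|reflexivity].
  apply (@filterdiff_comp' R_AbsRing R_NormedModule C_R_NormedModule R_NormedModule g (fun z : C => fst z) t
     (fun y => @scal R_AbsRing C_R_NormedModule y l) (fun z : C => fst z)).
  - exact H.
  - apply (@filterdiff_linear R_AbsRing C_R_NormedModule R_NormedModule).
    exact (@is_linear_fst R_AbsRing R_NormedModule R_NormedModule).
Qed.

Lemma is_derive_snd (g : R -> C) (t : R) (l : C) :
  @is_derive R_AbsRing C_R_NormedModule g t l -> is_derive (fun s => snd (g s)) t (snd l).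
Proof.
  intros H. unfold is_derive in *.
  apply filterdiff_ext_lin with (l1 := fun y => snd (@scal R_AbsRing C_R_NormedModule y l)); [|reflexivity].
  apply (@filterdiff_comp' R_AbsRing R_NormedModule C_R_NormedModule R_NormedModule g (fun z : C => snd z) t
     (fun y => @scal R_AbsRing C_R_NormedModule y l) (fun z : C => snd z)).
  - exact H.
  - apply (@filterdiff_linear R_AbsRing C_R_NormedModule R_NormedModule).
    exact (@is_linear_snd R_AbsRing R_NormedModule R_NormedModule).
Qed.

Lemma log_gauge_derive (p : C) (g : R -> C) (t : R) (l : C) : Cmod p < 1 -> Cmod (g t) < 1 ->
  @is_derive R_AbsRing C_R_NormedModule g t l ->
  is_derive (fun s => log_gauge p (g s)) t
    (fst (- 2 * (l * ((Cconj (g t) - Cconj p) / ((1 - g t * Cconj (g t)) * (1 - Cconj p * g t)))))%C).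
Proof.
  intros Hp Hg Hd.
  assert (H1 := is_derive_fst g t l Hd). assert (H2 := is_derive_snd g t l Hd).
  assert (P := Cmod_pos_neq _ (mobius_den_neq0 p (g t) Hp ltac:(lra))).
  assert (Q2 : 0 < Cmod (1 - Cconj p * g t)%C ^ 2) by (apply pow_lt, P).
  assert (Q1 : 0 < 1 - Cmod (g t) ^ 2) by (generalize (Cmod_ge_0 (g t)); nra).
  rewrite Cmod_sq in Q1, Q2.
  unfold log_gauge.
  apply is_derive_ext with (f := fun s => ln (1 - (fst (g s) ^ 2 + snd (g s) ^ 2)) -
    ln ((1 - (fst p * fst (g s) + snd p * snd (g s))) ^ 2 + (fst p * snd (g s) - snd p * fst (g s)) ^ 2)).
  { intros s. rewrite !Cmod_sq. f_equal; f_equal. simpl. ring. }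
  set (X := fun s => fst (g s)) in *. set (Y := fun s => snd (g s)) in *.
  apply is_derive_ext with (f := fun s => ln (1 - (X s ^ 2 + Y s ^ 2)) -
    ln ((1 - (fst p * X s + snd p * Y s)) ^ 2 + (fst p * Y s - snd p * X s) ^ 2)).
  { reflexivity. }
  assert (EX : fst (g t) = X t) by reflexivity. assert (EY : snd (g t) = Y t) by reflexivity.
  assert (H1' : is_derive X t (fst l)) by exact H1.
  assert (H2' : is_derive Y t (snd l)) by exact H2.
  clearbody X Y.
  set (q := (1 - (fst p * X t + snd p * Y t)) ^ 2 + (fst p * Y t - snd p * X t) ^ 2).
  assert (Eq : fst (1 - Cconj p * g t)%C ^ 2 + snd (1 - Cconj p * g t)%C ^ 2 = q).
  { unfold q. simpl. rewrite EX, EY. ring. }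
  rewrite EX, EY in Q1. rewrite Eq in Q2.
  assert (Einv : ((Cconj (g t) - Cconj p) / ((1 - g t * Cconj (g t)) * (1 - Cconj p * g t)))%C =
    ((Cconj (g t) - Cconj p) * Cconj (1 - Cconj p * g t) * RtoC (/ ((1 - (X t ^ 2 + Y t ^ 2)) * q)))%C).
  { assert (N := mobius_den_neq0 p (g t) Hp ltac:(lra)).
    rewrite <- Cmod2_conj, Cmod_sq, EX, EY, <- RtoC_minus.
    assert (N1 : RtoC (1 - (X t ^ 2 + Y t ^ 2)) <> 0%C) by (apply RtoC_inj_neq; lra).
    assert (N2 : RtoC q <> 0%C) by (apply RtoC_inj_neq; lra).
    rewrite RtoC_inv by (apply Rgt_not_eq, Rmult_lt_0_compat; lra). rewrite RtoC_mult.
    assert (Bq : (Cconj (1 - Cconj p * g t) = RtoC q / (1 - Cconj p * g t))%C).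
    { rewrite <- Eq, <- Cmod_sq, Cmod2_conj. field. exact N. }
    rewrite Bq. field. auto. }
  rewrite Einv. clear Einv Eq.
  auto_derive.
  - unfold q in Q2. repeat split; try (eexists; eassumption); simpl in *; lra.
  - rewrite (is_derive_unique (fun x : R => X x) t _ H1'), (is_derive_unique (fun x : R => Y x) t _ H2').
    replace (g t) with ((X t, Y t) : C) by (rewrite <- EX, <- EY; symmetry; apply surjective_pairing).
    destruct l as [l1 l2], p as [p1 p2]. unfold q in *. simpl in *. field.
    repeat split; nra.
Qed.

(** The left-hand side is half the size of the gradient of [log_gauge p]; hence
    [log_gauge p] is 2-Lipschitz for the Poincare metric. *)
Lemma Cmod_mobius_kernel (p z : C) : Cmod p < 1 -> Cmod z < 1 ->
  Cmod ((Cconj z - Cconj p) / ((1 - z * Cconj z) * (1 - Cconj p * z)))%C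
    <= Cmod (/ (1 - z * Cconj z))%C.
Proof.
  intros Hp Hz. assert (N := mobius_den_neq0 p z Hp ltac:(lra)).
  assert (N1 : (1 - z * Cconj z)%C <> 0%C).
  { rewrite <- Cmod2_conj, <- RtoC_minus. apply RtoC_inj_neq.
    generalize (Cmod_ge_0 z); nra. }
  replace ((Cconj z - Cconj p) / ((1 - z * Cconj z) * (1 - Cconj p * z)))%C
    with ((- Cconj (p - z) / (1 - Cconj p * z)) * / (1 - z * Cconj z))%C.
  2:{ replace (Cconj (p - z)) with (Cconj p - Cconj z)%C.
      - field. auto.
      - unfold Cconj, Cminus, Cplus, Copp; simpl. f_equal; ring. }
  rewrite Cmod_mult, Cmod_div by exact N. rewrite Cmod_opp, Cmod_conj.
  rewrite <- Cmod_div by exact N. fold (mobius p z).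
  generalize (mobius_lt1 p z Hp Hz) (Cmod_ge_0 (/ (1 - z * Cconj z))%C). nra.
Qed.

Lemma C1_path_gauge (p : C) (g dg : R -> C) : Cmod p < 1 -> C1_path_in_disk g dg ->
  0 <= C1_path_length g dg /\
  Rabs (log_gauge p (g 1) - log_gauge p (g 0)) <= 2 * C1_path_length g dg.
Proof.
  intros Hp Hg.
  set (G := fun u : C => g (fst u)). set (L := fun u : C => dg (fst u)).
  set (F := fun u => (L u * / (1 - G u * Cconj (G u)))%C).
  set (A := fun u => (- 2 * (L u * ((Cconj (G u) - Cconj p) / ((1 - G u * Cconj (G u)) * (1 - Cconj p * G u)))))%C).
  assert (CG : forall t, 0 <= t <= 1 -> ccont G (RtoC t)).
  { intros t Ht. apply ccont_of_path. destruct (Hg t Ht) as (_ & D & _).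
    apply (@ex_derive_continuous R_AbsRing C_R_NormedModule). eexists. exact D. }
  assert (CL : forall t, 0 <= t <= 1 -> ccont L (RtoC t)).
  { intros t Ht. apply ccont_of_path. apply (Hg t Ht). }
  assert (HG : forall t, 0 <= t <= 1 -> Cmod (g t) < 1) by (intros t Ht; apply (Hg t Ht)).
  assert (N1 : forall t, 0 <= t <= 1 -> (1 - g t * Cconj (g t))%C <> 0%C).
  { intros t Ht. rewrite <- Cmod2_conj, <- RtoC_minus. apply RtoC_inj_neq.
    generalize (Cmod_ge_0 (g t)) (HG t Ht); nra. }
  assert (N2 : forall t, 0 <= t <= 1 -> (1 - Cconj p * g t)%C <> 0%C).
  { intros t Ht. apply mobius_den_neq0; [exact Hp|]. generalize (HG t Ht); lra. }
  assert (CF : forall t, 0 <= t <= 1 -> ccont F (RtoC t)).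
  { intros t Ht. apply ccont_mult; [now apply CL|]. apply ccont_inv; [|now apply (N1 t)].
    apply ccont_minus; [apply ccont_const|]. apply ccont_mult; [|apply ccont_conj]; now apply CG. }
  assert (CA : forall t, 0 <= t <= 1 -> ccont A (RtoC t)).
  { intros t Ht. assert (C1 := CG t Ht). assert (C2 := CL t Ht).
    apply ccont_mult; [apply ccont_const|]. apply ccont_mult; [exact C2|].
    apply ccont_mult.
    - apply ccont_minus; [now apply ccont_conj|apply ccont_const].
    - apply ccont_inv; [|apply Cmult_neq_0; [now apply (N1 t)|now apply (N2 t)]].
      apply ccont_mult; (apply ccont_minus; [apply ccont_const|]); apply ccont_mult;
        auto using ccont_conj, ccont_const. }
  assert (Len : C1_path_length g dg = RInt (fun t => Cmod (F (RtoC t))) 0 1).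
  { unfold C1_path_length. apply RInt_ext. intros t Ht.
    rewrite Rmin_left, Rmax_right in Ht by lra. assert (Ht' : 0 <= t <= 1) by lra.
    unfold F, L, G; simpl. rewrite Cmod_mult, Cmod_inv by (now apply N1).
    unfold poincare_density. rewrite <- Cmod2_conj, <- RtoC_minus, Cmod_R, Rabs_pos_eq.
    - simpl. ring.
    - generalize (Cmod_ge_0 (g t)) (HG t Ht'); nra. }
  assert (EF : ex_RInt (fun t => Cmod (F (RtoC t))) 0 1).
  { apply (@ex_RInt_continuous R_CompleteNormedModule). intros t.
    rewrite Rmin_left, Rmax_right by lra. intros Ht. now apply continuous_Cmod_real_axis, CF. }
  assert (IA : is_RInt (fun t => fst (A (RtoC t))) 0 1 (log_gauge p (g 1) - log_gauge p (g 0))).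
  { apply (@is_RInt_derive R_CompleteNormedModule (fun t => log_gauge p (g t))).
    - intros t. rewrite Rmin_left, Rmax_right by lra. intros Ht.
      apply log_gauge_derive; [exact Hp|now apply HG|]. apply (Hg t Ht).
    - intros t. rewrite Rmin_left, Rmax_right by lra. intros Ht.
      now apply continuous_fst_real_axis, CA. }
  assert (Bd : forall t, 0 <= t <= 1 -> Rabs (fst (A (RtoC t))) <= 2 * Cmod (F (RtoC t))).
  { intros t Ht. eapply Rle_trans; [apply Cmod_fst|]. unfold A, F, L, G; simpl fst.
    rewrite !Cmod_mult. replace (Cmod (-2)) with 2 by (rewrite Cmod_R, Rabs_left; lra).
    apply Rmult_le_compat_l; [lra|]. apply Rmult_le_compat_l; [apply Cmod_ge_0|].
    apply Cmod_mobius_kernel; [exact Hp|now apply HG]. }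
  assert (I2 : is_RInt (fun t => 2 * Cmod (F (RtoC t))) 0 1 (2 * C1_path_length g dg)).
  { rewrite Len. apply (@is_RInt_scal R_NormedModule). now apply (@RInt_correct R_CompleteNormedModule). }
  split.
  - rewrite Len. apply RInt_ge_0; [lra|exact EF|]. intros; apply Cmod_ge_0.
  - apply Rabs_le. split.
    + apply (is_RInt_le (fun t => - (2 * Cmod (F (RtoC t)))) (fun t => fst (A (RtoC t))) 0 1); [lra| |exact IA|].
      * exact (@is_RInt_opp R_NormedModule _ _ _ _ I2).
      * intros t Ht. specialize (Bd t ltac:(lra)). apply Rabs_le_between in Bd. lra.
    + apply (is_RInt_le (fun t => fst (A (RtoC t))) (fun t => 2 * Cmod (F (RtoC t))) 0 1); [lra|exact IA|exact I2|].
      intros t Ht. specialize (Bd t ltac:(lra)). apply Rabs_le_between in Bd. lra.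
Qed.

(** A bound by a difference of values of [log_gauge p] is additive under
    concatenation, and so passes to piecewise C^1 paths. *)
Lemma path_length_gauge (p z w : C) (l : R) : Cmod p < 1 -> path_length z w l ->
  0 <= l /\ Rabs (log_gauge p w - log_gauge p z) <= 2 * l.
Proof.
  intros Hp H. induction H as [g dg Hg|z w u l1 l2 _ [H1 H2] _ [H3 H4]].
  - now apply C1_path_gauge.
  - split; [lra|]. apply Rabs_le_between in H2. apply Rabs_le_between in H4. apply Rabs_le. lra.
Qed.

Lemma mobius_le_of_hyperbolic_disk (p z : C) (r : R) : Cmod p < 1 ->
  hyperbolic_disk p r z -> Cmod (mobius p z) ^ 2 <= 1 - exp (- 2 * r).
Proof.
  intros Hp [Hz Hd]. unfold unit_disk in Hz.
  (* The infimum is finite, as lengths are nonnegative and some path exists, so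
     its real value is the infimum itself *)
  assert (Hl : exists l, path_length z p l /\ l < r).
  { apply NNPP. intros N.
    assert (LB : is_lb_Rbar (path_length z p) r).
    { intros l Hl. simpl. apply Rnot_lt_le. intros L. apply N. eauto. }
    destruct (mobius_geodesic p z Hp Hz) as (l0 & Hl0 & _).
    assert (LB0 : is_lb_Rbar (path_length z p) 0).
    { intros l Hl. exact (proj1 (path_length_gauge p z p l Hp Hl)). }
    unfold poincare_dist in Hd.
    destruct (Glb_Rbar_correct (path_length z p)) as [G1 G2].
    assert (A := G2 _ LB). assert (B := G1 _ Hl0). assert (D := G2 _ LB0).
    destruct (Glb_Rbar (path_length z p)); simpl in *; try contradiction; lra. }
  destruct Hl as (l & Hl & Hlr).
  destruct (path_length_gauge p z p l Hp Hl) as [_ G].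
  assert (E := exp_log_gauge p z Hp Hz). apply Rabs_le_between in G.
  cut (exp (-2 * r) <= 1 - Cmod (mobius p z) ^ 2); [lra|]. rewrite E.
  apply Rlt_le, exp_increasing. lra.
Qed.

Lemma hyperbolic_disk_of_mobius (p z : C) (r t : R) : Cmod p < 1 -> Cmod z < 1 ->
  t < 1 -> Cmod (mobius p z) <= t -> 1 / (1 - t ^ 2) < r -> hyperbolic_disk p r z.
Proof.
  intros Hp Hz Ht1 Ht Hr. split; [exact Hz|]. unfold poincare_dist.
  assert (H0 := Cmod_ge_0 (mobius p z)).
  destruct (mobius_geodesic p z Hp Hz) as (l & Hl & Hle).
  assert (Q : 1 / (1 - Cmod (mobius p z) ^ 2) <= 1 / (1 - t ^ 2)).
  { apply Rmult_le_compat_l; [lra|]. apply Rinv_le_contravar; nra. }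
  assert (P : 0 < 1 / (1 - t ^ 2)) by (apply Rdiv_lt_0_compat; nra).
  destruct (Glb_Rbar_correct (path_length z p)) as [G1 _]. specialize (G1 _ Hl).
  destruct (Glb_Rbar (path_length z p)); simpl in *; lra.
Qed.

(** * The Bloch condition in terms of pseudo-hyperbolic disks *)

Lemma rho_Bloch_hits (X : C -> Prop) : rho_Bloch X ->
  exists t, 0 <= t < 1 /\ forall p, Cmod p < 1 ->
    exists w, Cmod w < 1 /\ ~ X w /\ Cmod (mobius p w) <= t.
Proof.
  intros HB. unfold rho_Bloch, bloch_radius in HB.
  set (E := fun r : R => _) in HB.
  destruct (Lub_Rbar_correct E) as [U _].
  assert (HR : exists r, 0 < r /\ ~ E r).
  { destruct (Lub_Rbar E) as [m| |]; simpl in HB; try contradiction.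
    - exists (Rabs m + 1). split; [generalize (Rabs_pos m); lra|].
      intros HE. specialize (U _ HE). simpl in U. generalize (Rle_abs m); lra.
    - exists 1. split; [lra|]. intros HE. exact (U _ HE). }
  destruct HR as (r & Hr & HE).
  assert (He : 0 < exp (-2 * r) < 1).
  { split; [apply exp_pos|]. rewrite <- exp_0. apply exp_increasing. lra. }
  exists (sqrt (1 - exp (-2 * r))). split.
  { split; [apply sqrt_pos|]. rewrite <- sqrt_1 at 2. apply sqrt_lt_1; lra. }
  intros p Hp. apply NNPP. intros N. apply HE. split; [exact Hr|]. exists p.
  split; [exact Hp|]. intros w Hw. apply NNPP. intros Xw. apply N. exists w.
  split; [apply Hw|]. split; [exact Xw|].
  rewrite <- (sqrt_pow2 (Cmod (mobius p w))) by apply Cmod_ge_0.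
  apply sqrt_le_1_alt. now apply mobius_le_of_hyperbolic_disk.
Qed.

Lemma not_rho_Bloch_disks (X : C -> Prop) : ~ rho_Bloch X ->
  forall t, 0 <= t < 1 -> exists p, Cmod p < 1 /\
    forall z, Cmod z < 1 -> Cmod (mobius p z) <= t -> X z.
Proof.
  intros HB t Ht. unfold rho_Bloch, bloch_radius in HB.
  set (E := fun r : R => _) in HB.
  destruct (Lub_Rbar_correct E) as [_ L].
  assert (HR : exists r, E r /\ 1 / (1 - t ^ 2) < r).
  { apply NNPP. intros N. apply HB.
    assert (U : is_ub_Rbar E (1 / (1 - t ^ 2))).
    { intros r Hr. simpl. apply Rnot_lt_le. intros Q. apply N. eauto. }
    specialize (L _ U). destruct (Lub_Rbar E); simpl in *; trivial. }
  destruct HR as (r & (Hr & p & Hp & HX) & Htr).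
  exists p. split; [exact Hp|]. intros z Hz Hm. apply HX.
  now apply hyperbolic_disk_of_mobius with t.
Qed.

(** * Bloch subdomains are degenerate *)

(** Two points at bounded hyperbolic distance have comparable distances to the
    unit circle. *)
Lemma mobius_comparable_defects (a b : C) (e : R) : Cmod a < 1 -> Cmod b < 1 -> 0 < e ->
  e <= 1 - Cmod (mobius a b) ^ 2 -> e * (1 - Cmod b) <= 4 * (1 - Cmod a).
Proof.
  intros Ha Hb He H.
  assert (E := mobius_sq a b Ha ltac:(lra)).
  assert (A0 := Cmod_ge_0 a). assert (B0 := Cmod_ge_0 b).
  assert (D : 1 - Cmod b <= Cmod (1 - Cconj a * b)%C).
  { generalize (Cmod_le_add_sub 1%C (Cconj a * b)%C). rewrite Cmod_1, Cmod_mult, Cmod_conj. nra. }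
  set (d := Cmod (1 - Cconj a * b)%C) in *.
  set (m := 1 - Cmod (mobius a b) ^ 2) in *.
  set (x := Cmod a) in *. set (y := Cmod b) in *.
  assert (D2 : (1 - y) ^ 2 <= d ^ 2) by (apply pow_incr; lra).
  assert (K : e * (1 - y) ^ 2 <= m * d ^ 2).
  { apply Rmult_le_compat; try lra. apply pow2_ge_0. }
  rewrite E in K. apply Rmult_le_reg_r with (1 - y); [lra|].
  apply Rle_trans with ((1 - x ^ 2) * (1 - y ^ 2)); [lra|].
  replace (4 * (1 - x) * (1 - y)) with ((2 * (1 - x)) * (2 * (1 - y))) by ring.
  apply Rmult_le_compat; nra.
Qed.

Lemma mobius_defect_lower (x y : C) (x0 r : R) : Cmod x <= x0 -> x0 < 1 -> Cmod y = r -> r < 1 ->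
  (1 - x0 ^ 2) * (1 - r ^ 2) / 4 <= 1 - Cmod (mobius x y) ^ 2.
Proof.
  intros Hx Hx0 Hy Hr.
  assert (E := mobius_sq x y ltac:(lra) ltac:(lra)). rewrite Hy in E.
  assert (B := mobius_den_bounds x y ltac:(lra)).
  assert (X0 := Cmod_ge_0 x). assert (Y0 := Cmod_ge_0 y).
  assert (L := mobius_lt1 x y ltac:(lra) ltac:(lra)). assert (L0 := Cmod_ge_0 (mobius x y)).
  set (d := Cmod (1 - Cconj x * y)%C) in *. set (m := Cmod (mobius x y)) in *.
  set (a := Cmod x) in *.
  assert (d ^ 2 <= 4) by nra.
  assert (0 <= 1 - m ^ 2) by nra.
  assert (K : (1 - m ^ 2) * d ^ 2 <= (1 - m ^ 2) * 4) by (apply Rmult_le_compat_l; lra).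
  rewrite E in K.
  assert ((1 - x0 ^ 2) * (1 - r ^ 2) <= (1 - a ^ 2) * (1 - r ^ 2)).
  { apply Rmult_le_compat_r; nra. }
  lra.
Qed.

Lemma mobius_zero (w z : C) : Cmod w < 1 -> Cmod z <= 1 -> mobius w z = 0%C -> z = w.
Proof.
  intros Hw Hz E. assert (N := mobius_den_neq0 w z Hw Hz).
  replace z with (w - mobius w z * (1 - Cconj w * z))%C.
  - rewrite E. ring.
  - unfold mobius. field. exact N.
Qed.

(** Stability in the Schwarz lemma.  Let [f z = - z * H z].  If [Cmod (H x)] is
    nearly 1, then by the Schwarz-Pick lemma so is [Cmod (H y)] on the circle of
    radius [r], where [r] is nearly 1.  So [mobius w o f] is there nearly of
    modulus 1.  But it has no zero, and the maximum principle for its inverse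
    gives the same lower bound at 0, where its modulus is [Cmod w <= t]. *)
Lemma omitted_value_contraction_origin (t x0 : R) : 0 <= t < 1 -> 0 <= x0 < 1 ->
  exists k, 0 <= k < 1 /\ forall (f : C -> C) (x w : C),
    (forall z, Cmod z < 1 -> cdiff f z) -> (forall z, Cmod z < 1 -> Cmod (f z) < 1) ->
    f 0%C = 0%C -> Cmod w <= t -> (forall z, Cmod z < 1 -> f z <> w) ->
    Cmod x <= x0 -> Cmod (f x) <= k * Cmod x.
Proof.
  intros Ht Hx0.
  set (eta := (1 - t ^ 2) * (1 - t) ^ 2).
  assert (He : 0 < eta <= 1).
  { unfold eta. assert (0 < 1 - t ^ 2 <= 1) by nra. assert (0 < (1 - t) ^ 2 <= 1) by nra.
    split; [apply Rmult_lt_0_compat; lra|]. nra. }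
  (* [eta] is such that 1 - s^2 < eta implies that mobius w sends the circle of
     radius s outside the disk of radius t, for |w| <= t; the other constants
     leave room for this with s = 1 - 3 * eta / 16 *)
  set (r := 1 - eta / 8).
  assert (Hr : 0 < r < 1) by (unfold r; lra).
  set (e := (1 - x0 ^ 2) * (1 - r ^ 2) / 4).
  assert (Hee : 0 < e <= 1).
  { unfold e. assert (0 < 1 - x0 ^ 2 <= 1) by nra. assert (0 < 1 - r ^ 2 <= 1) by nra.
    assert (0 < (1 - x0 ^ 2) * (1 - r ^ 2)) by (apply Rmult_lt_0_compat; lra). nra. }
  set (k := 1 - e * eta / 64).
  assert (Hk : 0 <= k < 1) by (unfold k; nra).
  exists k. split; [exact Hk|]. intros f x w Hd H1 H0 Hw Hom Hx.
  destruct (classic (x = 0%C)) as [->|Nx].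
  { rewrite H0, Cmod_0. lra. }
  assert (Px := Cmod_pos_neq x Nx).
  assert (Hn := nearly_holo_of_cdiff f Hd).
  destruct (schwarz_factor f 0%C Hn) as (H & HH & HH1 & HE & HD).
  { intros z Hz. apply Rlt_le. now apply H1. }
  { rewrite Cmod_0. lra. }
  { exact H0. }
  { apply Hd. rewrite Cmod_0. lra. }
  assert (Ef : forall z, Cmod z < 1 -> Cmod (f z) = Cmod z * Cmod (H z)).
  { intros z Hz. rewrite HE, mobius_at_0, Cmod_mult, Cmod_opp; trivial. }
  apply Rnot_lt_le. intros Lk. rewrite Ef in Lk by lra.
  set (c := Cmod (H x)) in *.
  assert (Hc : k < c <= 1).
  { split; [|apply HH1; lra]. apply Rmult_lt_reg_l with (Cmod x); lra. }
  (* [H] may have modulus 1, and Schwarz-Pick needs values in the open disk: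
     [H] is scaled by [lam], while lam * c > k is kept *)
  set (lam := (k / c + 1) / 2).
  assert (Hkc : 0 <= k / c < 1).
  { split; [apply Rdiv_le_0_compat; lra|]. apply Rmult_lt_reg_r with c; [lra|].
    unfold Rdiv. rewrite Rmult_assoc, Rinv_l by lra. lra. }
  assert (Hlam : 0 < lam < 1) by (unfold lam; lra).
  assert (Hlc : k < lam * c).
  { unfold lam. replace ((k / c + 1) / 2 * c) with ((k + c) / 2) by (field; lra). lra. }
  set (h := fun z => (lam * H z)%C).
  assert (Eh : forall z, Cmod (h z) = lam * Cmod (H z)).
  { intros z. unfold h. rewrite Cmod_mult, Cmod_R, Rabs_pos_eq; lra. }
  assert (Hh1 : forall z, Cmod z < 1 -> Cmod (h z) < 1).
  { intros z Hz. rewrite Eh. generalize (HH1 z Hz) (Cmod_ge_0 (H z)). nra. }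
  assert (Hhn : nearly_holo h).
  { apply nearly_holo_map with H; [| |exact HH]; intros z _ Q.
    - apply ccont_mult; [apply ccont_const|exact Q].
    - apply cdiff_mult; [apply cdiff_const|exact Q]. }
  assert (Lower : forall y, Cmod y = r -> 1 - 3 * eta / 16 <= Cmod (f y)).
  { intros y Hy.
    assert (SP := schwarz_pick h x y Hhn Hh1 ltac:(lra)
      ltac:(apply cdiff_mult; [apply cdiff_const|apply HD; [exact Nx|apply Hd; lra]]) ltac:(lra)).
    assert (Aw := mobius_defect_lower x y x0 r Hx ltac:(lra) Hy ltac:(lra)). fold e in Aw.
    assert (Sep := mobius_comparable_defects (h x) (h y) e ltac:(apply Hh1; lra) ltac:(apply Hh1; lra) ltac:(lra)).
    assert (Q := Cmod_ge_0 (mobius (h x) (h y))).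
    specialize (Sep ltac:(nra)).
    rewrite !Eh in Sep. fold c in Sep.
    assert (Hy1 : lam * Cmod (H y) <= Cmod (H y)) by (generalize (Cmod_ge_0 (H y)); nra).
    assert (e * (1 - Cmod (H y)) <= e * (eta / 16)).
    { apply Rle_trans with (4 * (1 - k)); [|unfold k; lra].
      apply Rle_trans with (4 * (1 - lam * c)); [|lra].
      eapply Rle_trans; [|exact Sep]. apply Rmult_le_compat_l; lra. }
    assert (1 - Cmod (H y) <= eta / 16) by (apply Rmult_le_reg_l with e; lra).
    rewrite Ef by lra. rewrite Hy. unfold r. nra. }
  (* Any number above [t] whose square is at most 1 - 3/8 * (1 - t^2) *)
  set (tau := (1 + t) / 2).
  assert (Hw1 : Cmod w < 1) by lra.
  assert (Hmw : forall z, Cmod z < 1 -> mobius w (f z) <> 0%C).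
  { intros z Hz E. apply (Hom z Hz). apply mobius_zero; trivial. apply Rlt_le. now apply H1. }
  assert (Bnd : forall y, Cmod y = r -> tau <= Cmod (mobius w (f y))).
  { intros y Hy. assert (Fy := H1 y ltac:(lra)). assert (Ly := Lower y Hy).
    assert (N := mobius_near_boundary w (f y) (Cmod (f y)) Hw1 eq_refl
      (conj (Cmod_ge_0 _) Fy)).
    assert (Q : (1 - Cmod (f y) ^ 2) / (1 - Cmod w) ^ 2 <= 3 / 8 * (1 - t ^ 2)).
    { assert (P : 0 < (1 - Cmod w) ^ 2) by (apply pow_lt; lra).
      apply Rmult_le_reg_r with ((1 - Cmod w) ^ 2); [exact P|].
      replace ((1 - Cmod (f y) ^ 2) / (1 - Cmod w) ^ 2 * (1 - Cmod w) ^ 2) with (1 - Cmod (f y) ^ 2) by (field; lra).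
      apply Rle_trans with (3 / 8 * eta); [nra|]. unfold eta. rewrite Rmult_assoc.
      apply Rmult_le_compat_l; [lra|]. apply Rmult_le_compat_l; [nra|].
      apply pow_incr. lra. }
    apply sq_le_sq; [apply Cmod_ge_0|]. unfold tau. nra. }
  assert (Htau : t < tau) by (unfold tau; lra).
  assert (HK : nearly_holo (fun z => / mobius w (f z))%C).
  { apply nearly_holo_of_cdiff. intros z Hz. apply cdiff_inv; [|now apply Hmw].
    apply cdiff_comp; [now apply Hd|]. apply cdiff_mobius; [exact Hw1|]. apply Rlt_le. now apply H1. }
  assert (M := max_principle _ r (/ tau) ltac:(lra) HK).
  assert (M0 : Cmod (/ mobius w (f 0))%C <= / tau).
  { apply M; [|rewrite Cmod_0; lra]. intros y Hy. rewrite Cmod_inv by (apply Hmw; lra).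
    apply Rinv_le_contravar; [lra|]. now apply Bnd. }
  rewrite H0, mobius_0 in M0.
  assert (Nw : w <> 0%C). { intros Ew. apply (Hom 0%C); [rewrite Cmod_0; lra|congruence]. }
  rewrite Cmod_inv in M0 by exact Nw.
  apply Rinv_le_contravar in M0; [|apply Rinv_0_lt_compat, Cmod_pos_neq, Nw].
  rewrite !Rinv_inv in M0. lra.
Qed.

(** Moving [w] and [f w] to 0 by automorphisms reduces this to the case of a map
    fixing the origin. *)
Lemma omitted_value_contraction (X : C -> Prop) (t x0 : R) :
  (forall z, X z -> unit_disk z) -> 0 <= t < 1 -> 0 <= x0 < 1 ->
  (forall p, Cmod p < 1 -> exists w, Cmod w < 1 /\ ~ X w /\ Cmod (mobius p w) <= t) ->
  exists k, 0 <= k < 1 /\ forall (f : C -> C) (z w : C),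
    holomorphic_map unit_disk X f -> Cmod z < 1 -> Cmod w < 1 ->
    Cmod (mobius w z) <= x0 -> Cmod (mobius (f w) (f z)) <= k * Cmod (mobius w z).
Proof.
  intros HX Ht Hx0 Hhit. destruct (omitted_value_contraction_origin t x0 Ht Hx0) as (k & Hk & Hcon).
  exists k. split; [exact Hk|]. intros f z w [Hf HfX] Hz Hw Hzw.
  assert (F1 : forall u, Cmod u < 1 -> Cmod (f u) < 1) by (intros u Hu; apply HX, HfX, Hu).
  assert (Fd : forall u, Cmod u < 1 -> cdiff f u) by (intros u Hu; apply ex_derive_cdiff, Hf, Hu).
  assert (Hfw := F1 w Hw).
  destruct (Hhit (f w) Hfw) as (v & Hv & HvX & Hvt).
  assert (G := Hcon (fun u => mobius (f w) (f (mobius w u))) (mobius w z) (mobius (f w) v)).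
  cbv beta in G. rewrite (mobius_involutive w z Hw Hz) in G. apply G; trivial.
  - intros u Hu. assert (Hu' := mobius_lt1 w u Hw Hu).
    apply (cdiff_comp (mobius (f w)) (fun u => f (mobius w u))).
    + apply cdiff_comp; [apply cdiff_mobius; lra|now apply Fd].
    + apply cdiff_mobius; [exact Hfw|apply Rlt_le; now apply F1].
  - intros u Hu. apply mobius_lt1; [exact Hfw|]. apply F1. now apply mobius_lt1.
  - rewrite mobius_0. apply mobius_self.
  - intros u Hu E. apply HvX. assert (Hu' := mobius_lt1 w u Hw Hu).
    rewrite <- (mobius_involutive (f w) v Hfw Hv), <- E, mobius_involutive by (trivial; now apply F1).
    apply HfX. exact Hu'.
Qed.

Lemma ifs_in (X : C -> Prop) (f : nat -> C -> C) : (forall z, X z -> unit_disk z) ->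
  (forall n, holomorphic_map unit_disk X (f n)) ->
  forall n z, unit_disk z -> unit_disk (ifs f n z).
Proof.
  intros HX Hf n. induction n; intros z Hz; simpl.
  - apply HX, Hf, Hz.
  - apply IHn, HX, Hf, Hz.
Qed.

Lemma ifs_contraction (X : C -> Prop) (f : nat -> C -> C) (k x0 : R) :
  (forall z, X z -> unit_disk z) -> (forall n, holomorphic_map unit_disk X (f n)) ->
  0 <= k < 1 ->
  (forall (f : C -> C) (z w : C),
    holomorphic_map unit_disk X f -> Cmod z < 1 -> Cmod w < 1 ->
    Cmod (mobius w z) <= x0 -> Cmod (mobius (f w) (f z)) <= k * Cmod (mobius w z)) ->
  forall n z w, Cmod z < 1 -> Cmod w < 1 -> Cmod (mobius w z) <= x0 ->
    Cmod (mobius (ifs f n w) (ifs f n z)) <= k ^ (S n) * Cmod (mobius w z).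
Proof.
  intros HX Hf Hk Hcon n. induction n; intros z w Hz Hw Hzw.
  - simpl. rewrite Rmult_1_r. now apply Hcon.
  - assert (Q := Hcon _ z w (Hf (S n)) Hz Hw Hzw).
    assert (P := Cmod_ge_0 (mobius w z)).
    assert (Pk : 0 <= k ^ S n) by (apply pow_le; lra).
    eapply Rle_trans; [apply (IHn (f (S n) z) (f (S n) w))|].
    + apply HX, Hf, Hz.
    + apply HX, Hf, Hw.
    + nra.
    + change (k ^ S (S n)) with (k * k ^ S n).
      eapply Rle_trans; [apply Rmult_le_compat_l; [exact Pk|exact Q]|]. right; ring.
Qed.

Lemma compact_singleton (z : C) : @compact_set C_UniformSpace (fun w => w = z).
Proof.
  intros I U _ Hc. destruct (Hc z eq_refl) as [i Hi]. exists (i :: nil).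
  intros w ->. exists i. split; [now left|exact Hi].
Qed.

Lemma strictly_increasing_ge (phi : nat -> nat) :
  (forall n, (phi n < phi (S n))%nat) -> forall n, (n <= phi n)%nat.
Proof. intros H n. induction n; [apply le_0_n|]. specialize (H n). lia. Qed.

Theorem rho_Bloch_degenerate (X : C -> Prop) :
  (forall z, X z -> unit_disk z) -> rho_Bloch X -> degenerate X.
Proof.
  intros HX HB f Hf F [_ (phi & Hphi & Hlim)].
  destruct (rho_Bloch_hits X HB) as (t & Ht & Hhit).
  exists (F 0%C). intros z Hz. unfold unit_disk in Hz.
  assert (Z0 : Cmod 0 < 1) by (rewrite Cmod_0; lra).
  destruct (omitted_value_contraction X t (Cmod z) HX Ht (conj (Cmod_ge_0 z) Hz) Hhit) as (k & Hk & Hcon).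
  assert (Con := ifs_contraction X f k (Cmod z) HX Hf Hk Hcon).
  cut (Cmod (F z - F 0)%C = 0).
  { intros E. apply Cmod_eq_0 in E. replace (F z) with ((F z - F 0) + F 0)%C by ring. rewrite E. ring. }
  apply Rle_antisym; [|apply Cmod_ge_0]. apply le_epsilon. intros e He.
  destruct (Hlim _ (compact_singleton z) ltac:(intros w ->; exact Hz) (e / 4) ltac:(lra)) as [N1 H1].
  destruct (Hlim _ (compact_singleton 0%C) ltac:(intros w ->; exact Z0) (e / 4) ltac:(lra)) as [N2 H2].
  destruct (pow_lt_1_zero k ltac:(rewrite Rabs_pos_eq; lra) (e / 4) ltac:(lra)) as [N3 H3].
  set (n := Nat.max N1 (Nat.max N2 N3)).
  specialize (H1 n ltac:(lia) z eq_refl). specialize (H2 n ltac:(lia) 0%C eq_refl).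
  assert (Hn := strictly_increasing_ge phi Hphi n).
  specialize (H3 (S (phi n)) ltac:(lia)).
  rewrite Rabs_pos_eq in H3 by (apply pow_le; lra).
  specialize (Con (phi n) z 0%C Hz Z0 ltac:(rewrite mobius_at_0, Cmod_opp; lra)).
  rewrite mobius_at_0, Cmod_opp in Con.
  assert (D := Cmod_sub_le_mobius (ifs f (phi n) 0) (ifs f (phi n) z)
    (ifs_in X f HX Hf (phi n) 0%C Z0) (ifs_in X f HX Hf (phi n) z Hz)).
  assert (P : k ^ S (phi n) * Cmod z <= k ^ S (phi n)).
  { assert (0 <= k ^ S (phi n)) by (apply pow_le; lra). generalize (Cmod_ge_0 z). nra. }
  generalize (Cmod_sub_triangle (F z) (ifs f (phi n) z) (F 0)).
  generalize (Cmod_sub_triangle (ifs f (phi n) z) (ifs f (phi n) 0) (F 0)).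
  rewrite (Cmod_sub_sym (F z) (ifs f (phi n) z)), (Cmod_sub_sym (ifs f (phi n) z) (ifs f (phi n) 0)). lra.
Qed.

(** * Uniform limits of holomorphic functions *)

Lemma C_cauchy_limit (a : nat -> C) :
  (forall e, 0 < e -> exists N, forall n m, (N <= n)%nat -> (N <= m)%nat -> Cmod (a n - a m)%C < e) ->
  exists l : C, forall e, 0 < e -> exists N, forall n, (N <= n)%nat -> Cmod (a n - l)%C < e.
Proof.
  intros H.
  destruct (Rcomplete.R_complete (fun n => fst (a n))) as [l1 H1].
  { intros e He. destruct (H e He) as [N HN]. exists N. intros n m Hn Hm.
    eapply Rle_lt_trans; [apply (Cmod_fst (a n - a m)%C)|]. apply HN; lia. }
  destruct (Rcomplete.R_complete (fun n => snd (a n))) as [l2 H2].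
  { intros e He. destruct (H e He) as [N HN]. exists N. intros n m Hn Hm.
    eapply Rle_lt_trans; [apply (Cmod_snd (a n - a m)%C)|]. apply HN; lia. }
  exists (l1, l2). intros e He.
  destruct (H1 (e/2)) as [N1 HN1]; [lra|]. destruct (H2 (e/2)) as [N2 HN2]; [lra|].
  exists (Nat.max N1 N2). intros n Hn.
  eapply Rle_lt_trans; [apply Cmod_le_abs|].
  specialize (HN1 n ltac:(lia)). specialize (HN2 n ltac:(lia)).
  change (Rabs (fst (a n) - l1) < e/2) in HN1. change (Rabs (snd (a n) - l2) < e/2) in HN2.
  change (Rabs (fst (a n) - l1) + Rabs (snd (a n) - l2) < e). lra.
Qed.

Lemma geometric_limit (a : nat -> C) (K : R) :
  (forall n, Cmod (a (S n) - a n)%C <= K * (1/2) ^ n) ->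
  exists l : C, forall n, Cmod (a n - l)%C <= 2 * K * (1/2) ^ n.
Proof.
  intros H.
  assert (P : forall n, 0 < (1/2) ^ n) by (intros n; apply pow_lt; lra).
  assert (K0 : 0 <= K). { specialize (H O). generalize (Cmod_ge_0 (a 1%nat - a 0%nat)%C). simpl in H. lra. }
  assert (T : forall k n, Cmod (a (n + k)%nat - a n)%C <= 2 * K * ((1/2) ^ n - (1/2) ^ (n + k))).
  { induction k; intros n.
    - rewrite PeanoNat.Nat.add_0_r. replace (a n - a n)%C with (RtoC 0) by ring. rewrite Cmod_0. lra.
    - rewrite PeanoNat.Nat.add_succ_r.
      generalize (Cmod_sub_triangle (a (S (n + k))) (a (n + k)%nat) (a n)) (H (n + k)%nat) (IHk n).
      change ((1/2) ^ S (n + k)) with (1/2 * (1/2) ^ (n + k)). lra. }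
  assert (T' : forall n m, (n <= m)%nat -> Cmod (a m - a n)%C <= 2 * K * (1/2) ^ n).
  { intros n m Hnm. replace m with (n + (m - n))%nat by lia.
    eapply Rle_trans; [apply T|]. apply Rmult_le_compat_l; [lra|].
    generalize (P (n + (m - n))%nat). lra. }
  destruct (C_cauchy_limit a) as [l Hl].
  { intros e He. destruct (half_pow_small (4 * K) e He) as [N HN]. exists N. intros n m Hn Hm.
    generalize (Cmod_sub_triangle (a n) (a N) (a m)) (T' N n Hn) (T' N m Hm).
    rewrite (Cmod_sub_sym (a N) (a m)). lra. }
  exists l. intros n. apply le_epsilon. intros e He. destruct (Hl e He) as [N HN].
  specialize (HN (Nat.max N n) ltac:(lia)).
  generalize (Cmod_sub_triangle (a n) (a (Nat.max N n)) l) (T' n (Nat.max N n) ltac:(lia)).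
  rewrite (Cmod_sub_sym (a n) (a (Nat.max N n))). lra.
Qed.

(** By the maximum principle the difference quotients [q n] of the [f n] at [z0],
    extended by the derivatives, converge uniformly along with the [f n].  Their
    limit is therefore continuous at [z0], and it is the quotient of [F]. *)
Lemma weierstrass (f : nat -> C -> C) (F : C -> C) :
  (forall n z, Cmod z < 1 -> cdiff (f n) z) ->
  (forall r, 0 <= r < 1 -> forall e, 0 < e -> exists N, forall n, (N <= n)%nat ->
     forall z, Cmod z <= r -> Cmod (f n z - F z)%C < e) ->
  forall z, Cmod z < 1 -> cdiff F z.
Proof.
  intros Hd Hu z0 Hz0.
  set (r := (1 + Cmod z0) / 2).
  assert (Z0 := Cmod_ge_0 z0).
  assert (Hr : 0 <= r < 1) by (unfold r; lra).
  set (s := r - Cmod z0). assert (Hs : 0 < s) by (unfold s, r; lra).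
  set (q := fun n => proj1_sig (constructive_indefinite_description _ (Hd n z0 Hz0))).
  assert (Hq : forall n, slope_at (f n) (q n) z0).
  { intros n. exact (proj2_sig (constructive_indefinite_description _ (Hd n z0 Hz0))). }
  assert (Cau : forall e, 0 < e -> exists N, forall n m, (N <= n)%nat -> (N <= m)%nat ->
     forall z, Cmod z <= r -> Cmod (q n z - q m z)%C <= e).
  { intros e He. destruct (Hu r Hr (e * s / 4)) as [N HN].
    { apply Rdiv_lt_0_compat; [|lra]. now apply Rmult_lt_0_compat. }
    exists N. intros n m Hn Hm.
    apply (max_principle (fun z => (q n z - q m z)%C) r e Hr).
    - assert (Nf : nearly_holo (fun z => (f n z - f m z)%C)).
      { apply nearly_holo_of_cdiff. intros z Hz. apply cdiff_minus; now apply Hd. }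
      apply nearly_holo_slope with (g := fun z => (f n z - f m z)%C) (x := z0); [exact Nf|].
      split; [apply ccont_minus; apply Hq|].
      intros w. rewrite (proj2 (Hq n) w), (proj2 (Hq m) w) at 1. ring.
    - intros z Hz.
      assert (Hsz : s <= Cmod (z - z0)%C).
      { generalize (Cmod_le_add_sub z z0). unfold s. lra. }
      assert (E : ((q n z - q m z) * (z - z0))%C = ((f n z - F z) - (f m z - F z) - ((f n z0 - F z0) - (f m z0 - F z0)))%C).
      { rewrite (proj2 (Hq n) z), (proj2 (Hq m) z). ring. }
      apply (f_equal Cmod) in E. rewrite Cmod_mult in E.
      assert (A1 := HN n Hn z ltac:(lra)). assert (A2 := HN m Hm z ltac:(lra)).
      assert (A3 := HN n Hn z0 ltac:(unfold r; lra)). assert (A4 := HN m Hm z0 ltac:(unfold r; lra)).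
      assert (B1 := Cmod_sub_le ((f n z - F z) - (f m z - F z))%C ((f n z0 - F z0) - (f m z0 - F z0))%C).
      assert (B2 := Cmod_sub_le (f n z - F z)%C (f m z - F z)%C).
      assert (B3 := Cmod_sub_le (f n z0 - F z0)%C (f m z0 - F z0)%C).
      apply Rmult_le_reg_r with s; [exact Hs|].
      apply Rle_trans with (Cmod (q n z - q m z)%C * Cmod (z - z0)%C); [|rewrite E; lra].
      apply Rmult_le_compat_l; [apply Cmod_ge_0|exact Hsz]. }
  destruct (C_cauchy_limit (fun n => q n z0)) as [l Hl].
  { intros e He. destruct (Cau (e/2)) as [N HN]; [lra|]. exists N. intros n m Hn Hm.
    specialize (HN n m Hn Hm z0 ltac:(unfold r; lra)). lra. }
  exists (fun w => if excluded_middle_informative (w = z0) then l else ((F w - F z0) / (w - z0))%C).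
  split.
  - intros e He.
    destruct (excluded_middle_informative (z0 = z0)) as [_|N]; [|now destruct N].
    destruct (Cau (e/5)) as [N1 HN1]; [lra|]. destruct (Hl (e/5)) as [N2 HN2]; [lra|].
    set (n := Nat.max N1 N2).
    destruct (proj1 (Hq n) (e/5)) as (d & D & Hqd); [lra|].
    exists (Rmin d s). split; [now apply Rmin_pos|]. intros w Hw.
    assert (W1 := Rlt_le_trans _ _ _ Hw (Rmin_l _ _)).
    assert (W2 := Rlt_le_trans _ _ _ Hw (Rmin_r _ _)).
    assert (Hwr : Cmod w <= r). { generalize (Cmod_le_add_sub w z0). unfold s in W2. lra. }
    destruct (excluded_middle_informative (w = z0)) as [->|Nw].
    { replace (l - l)%C with (RtoC 0) by ring. rewrite Cmod_0. exact He. }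
    assert (P := Cmod_sub_pos z0 w Nw).
    destruct (Hu r Hr (e/5 * Cmod (w - z0)%C / 2)) as [N3 HN3].
    { apply Rdiv_lt_0_compat; [|lra]. apply Rmult_lt_0_compat; lra. }
    set (m := Nat.max n N3).
    assert (A1 : Cmod ((F w - F z0) / (w - z0) - q m w)%C <= e/5).
    { replace ((F w - F z0) / (w - z0) - q m w)%C with (((f m z0 - F z0) - (f m w - F w)) / (w - z0))%C.
      2:{ rewrite (proj2 (Hq m) w). field. now apply Cminus_neq_0. }
      rewrite Cmod_div by (now apply Cminus_neq_0).
      apply Rmult_le_reg_r with (Cmod (w - z0)%C); [exact P|].
      unfold Rdiv at 1. rewrite Rmult_assoc, Rinv_l, Rmult_1_r by lra.
      generalize (Cmod_sub_le (f m z0 - F z0)%C (f m w - F w)%C)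
        (HN3 m ltac:(lia) w Hwr) (HN3 m ltac:(lia) z0 ltac:(unfold r; lra)). lra. }
    assert (A2 := HN1 m n ltac:(lia) ltac:(lia) w Hwr).
    assert (A3 := Hqd w W1). assert (A4 := HN2 n ltac:(lia)). cbv beta in A4.
    set (Q := ((F w - F z0) / (w - z0))%C) in *.
    generalize (Cmod_sub_triangle Q (q m w) l) (Cmod_sub_triangle (q m w) (q n w) l)
      (Cmod_sub_triangle (q n w) (q n z0) l). lra.
  - intros w. destruct (excluded_middle_informative (w = z0)) as [->|N]; [ring|].
    field. now apply Cminus_neq_0.
Qed.

(** * Degenerate subdomains are Bloch *)

Lemma mobius_lipschitz (p a b : C) : Cmod p < 1 -> Cmod a <= 1 -> Cmod b <= 1 ->
  Cmod (mobius p a - mobius p b)%C <= Cmod (a - b)%C / (1 - Cmod p) ^ 2.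
Proof.
  intros Hp Ha Hb.
  assert (Na := mobius_den_neq0 p a Hp Ha). assert (Nb := mobius_den_neq0 p b Hp Hb).
  assert (Ba := mobius_den_bounds p a Ha). assert (Bb := mobius_den_bounds p b Hb).
  assert (P0 := Cmod_ge_0 p). assert (A0 := Cmod_ge_0 (a - b)%C).
  replace (mobius p a - mobius p b)%C with
    ((p * Cconj p - 1) * (a - b) / ((1 - Cconj p * a) * (1 - Cconj p * b)))%C
    by (unfold mobius; field; auto).
  rewrite Cmod_div by (now apply Cmult_neq_0). rewrite !Cmod_mult.
  assert (E : Cmod (p * Cconj p - 1)%C <= 1).
  { rewrite <- Cmod2_conj, <- RtoC_minus, Cmod_R, Rabs_left1; nra. }
  apply Rmult_le_compat.
  - apply Rmult_le_pos; apply Cmod_ge_0.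
  - apply Rlt_le, Rinv_0_lt_compat, Rmult_lt_0_compat; lra.
  - nra.
  - apply Rinv_le_contravar; [apply pow_lt; lra|]. simpl. rewrite Rmult_1_r.
    apply Rmult_le_compat; lra.
Qed.

Lemma compact_in_disk (K : C -> Prop) : @compact_set C_UniformSpace K ->
  (forall z, K z -> unit_disk z) -> exists r, 0 <= r < 1 /\ forall z, K z -> Cmod z <= r.
Proof.
  intros HK HD.
  destruct (HK R (fun r z => Cmod z < r /\ r < 1)) as [l Hl].
  - intros r z [Hz Hr].
    assert (He : 0 < (r - Cmod z) / 2) by lra.
    exists (mkposreal _ He). intros w [H1 H2].
    split; [|exact Hr].
    change (Rabs (fst w - fst z) < (r - Cmod z) / 2) in H1.
    change (Rabs (snd w - snd z) < (r - Cmod z) / 2) in H2.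
    assert (A : Cmod (w - z)%C <= Rabs (fst w - fst z) + Rabs (snd w - snd z)) by apply Cmod_le_abs.
    generalize (Cmod_le_add_sub w z). lra.
  - intros z Hz. specialize (HD z Hz). unfold unit_disk in HD. exists ((Cmod z + 1) / 2). lra.
  - assert (Hmax : forall l' : list R, exists r, 0 <= r < 1 /\ forall i, In i l' -> i < 1 -> i <= r).
    { induction l' as [|i l' (r & Hr & IH)].
      - exists 0. split; [lra|]. intros i [].
      - destruct (Rlt_le_dec i 1) as [L|L].
        + exists (Rmax i r). split.
          { split; [eapply Rle_trans; [apply Hr|apply Rmax_r]|apply Rmax_lub_lt; lra]. }
          intros j [->|Hj] Hj1; [apply Rmax_l|]. eapply Rle_trans; [now apply IH|apply Rmax_r].
        + exists r. split; [exact Hr|]. intros j [->|Hj] Hj1; [lra|]. now apply IH. }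
    destruct (Hmax l) as (r & Hr & Hrl). exists r. split; [exact Hr|]. intros z Hz.
    destruct (Hl z Hz) as (i & Hi & H1 & H2). specialize (Hrl i Hi H2). lra.
Qed.

(** A two-fold Blaschke product with zeros 0 and [p], shrunk by [t].  The unit
    constant makes it tend to the identity when [p] tends to the unit circle and
    [t] to 1. *)
Definition fold_map (p : C) (t : R) (z : C) : C := (t * (Cconj p / Cmod p) * (z * mobius p z))%C.

Lemma Cmod_fold_map (p : C) (t : R) (z : C) : p <> 0%C -> 0 <= t ->
  Cmod (fold_map p t z) = t * (Cmod z * Cmod (mobius p z)).
Proof.
  intros Hp Ht. assert (P := Cmod_pos_neq p Hp). unfold fold_map.
  rewrite !Cmod_mult, Cmod_div by (apply RtoC_inj_neq; lra).
  rewrite Cmod_conj, !Cmod_R, !Rabs_pos_eq by lra. field. lra.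
Qed.

Lemma fold_map_mobius (p : C) (t : R) (z : C) : Cmod p < 1 -> Cmod z < 1 ->
  fold_map p t (mobius p z) = fold_map p t z.
Proof. intros Hp Hz. unfold fold_map. rewrite mobius_involutive by trivial. ring. Qed.

Lemma cdiff_fold_map (p : C) (t : R) (z : C) : Cmod p < 1 -> Cmod z <= 1 ->
  cdiff (fold_map p t) z.
Proof.
  intros Hp Hz. apply cdiff_mult; [apply cdiff_const|].
  apply cdiff_mult; [apply cdiff_id|now apply cdiff_mobius].
Qed.

Lemma fold_map_near_id (p : C) (t e : R) (z : C) : 0 < e < 1 ->
  1 - e <= Cmod p -> Cmod p < 1 -> 1 - e <= t -> t < 1 -> Cmod z < 1 ->
  Cmod (fold_map p t z - z)%C <= 3 * e / (1 - Cmod z).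
Proof.
  intros He Hp1 Hp Ht1 Ht Hz.
  assert (Np : p <> 0%C) by (apply Cmod_gt_0; lra).
  assert (N := mobius_den_neq0 p z Hp ltac:(lra)).
  assert (Z0 := Cmod_ge_0 z).
  assert (Nr : RtoC (Cmod p) <> 0%C) by (apply RtoC_inj_neq; lra).
  set (c := (Cconj p / Cmod p)%C).
  assert (Hc : Cmod c = 1).
  { unfold c. rewrite Cmod_div, Cmod_conj, Cmod_R, Rabs_pos_eq by (trivial; lra). field. lra. }
  assert (Ec : Cconj p = (Cmod p * c)%C) by (unfold c; field; exact Nr).
  assert (Epc : (c * p)%C = Cmod p).
  { unfold c. replace (Cconj p / Cmod p * p)%C with ((p * Cconj p) / Cmod p)%C by (field; exact Nr).
    rewrite <- Cmod2_conj, <- RtoC_div by lra. f_equal. field. lra. }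
  assert (E : (fold_map p t z - z)%C =
    (- z * (t * ((1 - Cmod p) * (1 + c * z) / (1 - Cconj p * z)) + (1 - t)))%C).
  { assert (Es : (c * mobius p z - 1)%C = (- ((1 - Cmod p) * (1 + c * z) / (1 - Cconj p * z)))%C).
    { unfold mobius. apply Cmult_cancel_r with (1 - Cconj p * z)%C; [exact N|].
      transitivity (c * p - c * z - (1 - Cconj p * z))%C; [field; exact N|].
      transitivity (- ((1 - Cmod p) * (1 + c * z)))%C; [|field; exact N].
      rewrite Epc, Ec. ring. }
    unfold fold_map. fold c.
    replace (t * c * (z * mobius p z) - z)%C with (z * (t * (c * mobius p z - 1) - (1 - t)))%C by ring.
    rewrite Es. ring. }
  rewrite E, Cmod_mult, Cmod_opp.
  assert (D : 1 - Cmod z <= Cmod (1 - Cconj p * z)%C).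
  { generalize (Cmod_le_add_sub 1%C (Cconj p * z)%C). rewrite Cmod_1, Cmod_mult, Cmod_conj. nra. }
  assert (Q : Cmod ((1 - Cmod p) * (1 + c * z) / (1 - Cconj p * z))%C <= 2 * e / (1 - Cmod z)).
  { rewrite Cmod_div by exact N. rewrite Cmod_mult, <- RtoC_minus, Cmod_R, Rabs_pos_eq by lra.
    assert (T := Cmod_triangle 1%C (c * z)%C). rewrite Cmod_1, Cmod_mult, Hc in T.
    assert (T0 := Cmod_ge_0 (1 + c * z)%C).
    apply Rmult_le_compat.
    - apply Rmult_le_pos; lra.
    - apply Rlt_le, Rinv_0_lt_compat; lra.
    - nra.
    - apply Rinv_le_contravar; lra. }
  assert (Q2 : Cmod (t * ((1 - Cmod p) * (1 + c * z) / (1 - Cconj p * z)) + (1 - t))%C <= 3 * e / (1 - Cmod z)).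
  { eapply Rle_trans; [apply Cmod_triangle|]. rewrite Cmod_mult, <- (RtoC_minus 1 t), !Cmod_R.
    rewrite (Rabs_pos_eq t), (Rabs_pos_eq (1 - t)) by lra.
    assert (e <= e / (1 - Cmod z)).
    { apply Rmult_le_reg_r with (1 - Cmod z); [lra|].
      unfold Rdiv. rewrite Rmult_assoc, Rinv_l by lra. nra. }
    assert (S0 := Cmod_ge_0 ((1 - Cmod p) * (1 + c * z) / (1 - Cconj p * z))%C).
    replace (3 * e / (1 - Cmod z)) with (2 * e / (1 - Cmod z) + e / (1 - Cmod z)) by (field; lra).
    nra. }
  assert (S0 := Cmod_ge_0 (t * ((1 - Cmod p) * (1 + c * z) / (1 - Cconj p * z)) + (1 - t))%C).
  nra.
Qed.

(** A disk of radius close to 1 that avoids a fixed point [w0] has its center far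
    from [w0].  The radius used below is chosen so that the identity [mobius_sq]
    places the center within [e] of the unit circle. *)
Lemma disks_near_boundary (X : C -> Prop) (w0 : C) (e : R) : ~ rho_Bloch X ->
  Cmod w0 < 1 -> ~ X w0 -> 0 < e < 1 ->
  exists p, Cmod p < 1 /\ 1 - e <= Cmod p /\
    forall z, Cmod z < 1 -> Cmod (mobius p z) <= 1 - e -> X z.
Proof.
  intros HB Hw HX He. assert (W0 := Cmod_ge_0 w0).
  set (v := 1 - Cmod w0 ^ 2). assert (Hv : 0 < v <= 1) by (unfold v; nra).
  destruct (not_rho_Bloch_disks X HB (1 - e * v / 8)) as (p & Hp & HpX); [nra|].
  exists p. split; [exact Hp|]. split.
  - assert (L : 1 - e * v / 8 < Cmod (mobius p w0)).
    { apply Rnot_le_lt. intros L. apply HX. now apply HpX. }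
    assert (A := mobius_sq p w0 Hp ltac:(lra)). fold v in A.
    assert (B := mobius_den_bounds p w0 ltac:(lra)).
    assert (L1 := mobius_lt1 p w0 Hp Hw). assert (P0 := Cmod_ge_0 p).
    set (m := Cmod (mobius p w0)) in *. set (d := Cmod (1 - Cconj p * w0)%C) in *.
    assert (e * v / 8 <= 1/8) by nra.
    assert (1 - m ^ 2 < e * v / 4) by nra.
    assert (0 <= 1 - m ^ 2) by nra.
    assert (d ^ 2 <= 4) by nra.
    assert (K : (1 - Cmod p ^ 2) * v < e * v).
    { rewrite <- A. nra. }
    assert (1 - Cmod p ^ 2 < e) by (apply Rmult_lt_reg_r with v; lra).
    apply sq_le_sq; [exact P0|]. nra.
  - intros z Hz Hm. apply HpX; [exact Hz|]. nra.
Qed.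

(** Otherwise the identity maps the disk into [X], and its iterates converge to
    it. *)
Lemma degenerate_misses_point (X : C -> Prop) : degenerate X -> exists w, Cmod w < 1 /\ ~ X w.
Proof.
  intros HD. apply NNPP. intros N.
  assert (HX : forall z, unit_disk z -> X z).
  { intros z Hz. apply NNPP. intros Q. apply N. exists z. split; [exact Hz|exact Q]. }
  assert (Hid : forall n z, ifs (fun _ z => z) n z = z) by (induction n; simpl; auto).
  destruct (HD (fun _ z => z)) with (F := fun z : C => z) as [c Hc].
  - intros n. split; [|exact HX]. intros z _. apply ex_derive_cdiff, cdiff_id.
  - split; [intros z _; apply ex_derive_cdiff, cdiff_id|].
    exists (fun n => n). split; [lia|]. intros K _ _ e He. exists O. intros n _ z _.
    rewrite Hid. replace (z - z)%C with (RtoC 0) by ring. now rewrite Cmod_0.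
  - assert (E : RtoC 0 = RtoC (1/2)).
    { rewrite (Hc (RtoC 0)), (Hc (RtoC (1/2))); trivial; unfold unit_disk; rewrite Cmod_R.
      - rewrite Rabs_pos_eq; lra.
      - rewrite Rabs_R0; lra. }
    apply RtoC_inj in E. lra.
Qed.

Lemma ifs_cdiff (f : nat -> C -> C) :
  (forall n, holomorphic_map unit_disk unit_disk (f n)) ->
  forall n z, Cmod z < 1 -> cdiff (ifs f n) z.
Proof.
  intros Hf n. induction n; intros z Hz.
  - apply ex_derive_cdiff, (proj1 (Hf O)), Hz.
  - apply (cdiff_comp (ifs f n) (f (S n))).
    + apply ex_derive_cdiff, (proj1 (Hf (S n))), Hz.
    + apply IHn, (Hf (S n)), Hz.
Qed.

(** Consecutive compositions are [ifs m n] at [m (S n) z] and at [z], and [ifs m n]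
    does not increase the pseudo-hyperbolic distance: the errors add up as a
    geometric series. *)
Lemma ifs_near_id_converges (m : nat -> C -> C) (A : R) :
  (forall n, holomorphic_map unit_disk unit_disk (m n)) ->
  (forall n z, Cmod z < 1 -> Cmod (m n z) <= Cmod z) ->
  (forall n z, Cmod z < 1 -> Cmod (m n z - z)%C <= A * (1/2) ^ n / (1 - Cmod z)) ->
  exists F : C -> C,
    (forall z, Cmod z < 1 -> cdiff F z) /\ (forall z, Cmod z < 1 -> Cmod (F z) <= Cmod z) /\
    (forall n z, Cmod z < 1 ->
       Cmod (ifs m n z - F z)%C <= 2 * (A / (1 - Cmod z) ^ 2) * (1/2) ^ n).
Proof.
  intros Hm Hle Hid.
  assert (HA : 0 <= A).
  { generalize (Hid O 0%C ltac:(rewrite Cmod_0; lra)) (Cmod_ge_0 (m O 0 - 0)%C).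
    rewrite Cmod_0, Rminus_0_r. simpl. lra. }
  assert (Hin := ifs_in unit_disk m (fun z H => H) Hm).
  assert (Step : forall n z, Cmod z < 1 ->
    Cmod (ifs m (S n) z - ifs m n z)%C <= A / (1 - Cmod z) ^ 2 * (1/2) ^ n).
  { intros n z Hz. simpl ifs.
    assert (Hmz : Cmod (m (S n) z) < 1) by (apply (Hm (S n)), Hz).
    eapply Rle_trans.
    { apply Cmod_sub_le_mobius; apply Hin; [exact Hmz|exact Hz]. }
    assert (SP := schwarz_pick (ifs m n) (m (S n) z) z
      (nearly_holo_of_cdiff _ (ifs_cdiff m Hm n)) (Hin n) Hmz (ifs_cdiff m Hm n _ Hmz) Hz).
    assert (L := mobius_le_sub (m (S n) z) z (Cmod z) (Hle _ _ Hz) ltac:(lra) Hz).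
    assert (I := Hid (S n) z Hz).
    apply Rle_trans with (2 * (Cmod (m (S n) z - z)%C / (1 - Cmod z))); [lra|].
    replace (A / (1 - Cmod z) ^ 2 * (1/2) ^ n) with (2 * (A * (1/2) ^ S n / (1 - Cmod z) / (1 - Cmod z)))
      by (simpl; field; lra).
    apply Rmult_le_compat_l; [lra|]. apply Rmult_le_compat_r; [|exact I].
    apply Rlt_le, Rinv_0_lt_compat. lra. }
  assert (Lim : forall z, exists l : C, Cmod z < 1 ->
    forall n, Cmod (ifs m n z - l)%C <= 2 * (A / (1 - Cmod z) ^ 2) * (1/2) ^ n).
  { intros z. destruct (Rlt_le_dec (Cmod z) 1) as [Hz|Hz]; [|exists 0%C; lra].
    destruct (geometric_limit (fun n => ifs m n z) (A / (1 - Cmod z) ^ 2)) as [l Hl].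
    - intros n. now apply Step.
    - exists l. intros _. exact Hl. }
  set (F := fun z => proj1_sig (constructive_indefinite_description _ (Lim z))).
  assert (HF : forall n z, Cmod z < 1 -> Cmod (ifs m n z - F z)%C <= 2 * (A / (1 - Cmod z) ^ 2) * (1/2) ^ n).
  { intros n z Hz. exact (proj2_sig (constructive_indefinite_description _ (Lim z)) Hz n). }
  exists F. split; [|split; [|exact HF]].
  - apply weierstrass with (f := ifs m); [exact (ifs_cdiff m Hm)|].
    intros r Hr e He.
    destruct (half_pow_small (2 * (A / (1 - r) ^ 2)) e He) as [N HN]. exists N.
    intros n Hn z Hz. eapply Rle_lt_trans; [apply HF; lra|]. eapply Rle_lt_trans; [|exact HN].
    apply Rmult_le_compat.
    + apply Rmult_le_pos; [lra|]. apply Rdiv_le_0_compat; [exact HA|apply pow_lt; lra].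
    + apply pow_le; lra.
    + apply Rmult_le_compat_l; [lra|]. apply Rmult_le_compat_l; [exact HA|].
      apply Rinv_le_contravar; [apply pow_lt; lra|]. apply pow_incr; lra.
    + replace n with (N + (n - N))%nat by lia. rewrite pow_add.
      generalize (half_pow_bounds N) (half_pow_bounds (n - N)). intros. nra.
  - intros z Hz. apply le_epsilon. intros e He.
    destruct (half_pow_small (2 * (A / (1 - Cmod z) ^ 2)) e He) as [N HN].
    assert (B : forall n z, Cmod z < 1 -> Cmod (ifs m n z) <= Cmod z).
    { induction n; intros u Hu; simpl; [now apply Hle|].
      eapply Rle_trans; [apply IHn|]; [apply (Hm (S n)), Hu|now apply Hle]. }
    generalize (HF N z Hz) (B N z Hz) (Cmod_le_add_sub (F z) (ifs m N z)).
    rewrite (Cmod_sub_sym (F z)). lra.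
Qed.

Theorem degenerate_rho_Bloch (X : C -> Prop) : degenerate X -> rho_Bloch X.
Proof.
  intros HD. apply NNPP. intros HB.
  destruct (degenerate_misses_point X HD) as (w0 & Hw0 & HXw0).
  (* The factor 1/100 keeps the total displacement of 1/2 below 1/2 *)
  set (e := fun n => 1/100 * (1/2) ^ n).
  assert (Pn := half_pow_bounds).
  assert (He : forall n, 0 < e n < 1) by (intros n; unfold e; generalize (Pn n); lra).
  set (p := fun n => proj1_sig (constructive_indefinite_description _
    (disks_near_boundary X w0 (e n) HB Hw0 HXw0 (He n)))).
  assert (Hp : forall n, Cmod (p n) < 1 /\ 1 - e n <= Cmod (p n) /\
    forall z, Cmod z < 1 -> Cmod (mobius (p n) z) <= 1 - e n -> X z).
  { intros n. exact (proj2_sig (constructive_indefinite_description _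
    (disks_near_boundary X w0 (e n) HB Hw0 HXw0 (He n)))). }
  clearbody p.
  set (m := fun n => fold_map (p (S n)) (1 - e n)).
  set (f := fun n z => mobius (p n) (m n z)).
  assert (Hm : forall n z, Cmod z < 1 -> Cmod (m n z) <= 1 - e n /\ Cmod (m n z) <= Cmod z).
  { intros n z Hz. destruct (Hp (S n)) as (P1 & P2 & _).
    unfold m. rewrite Cmod_fold_map.
    - assert (S1 := mobius_lt1 _ z P1 Hz). assert (S0 := Cmod_ge_0 (mobius (p (S n)) z)).
      assert (Z0 := Cmod_ge_0 z). destruct (He n).
      assert (0 <= Cmod z * Cmod (mobius (p (S n)) z) <= Cmod z) by nra. nra.
    - apply Cmod_gt_0. generalize (He (S n)); lra.
    - generalize (He n); lra. }
  assert (Hmh : forall n, holomorphic_map unit_disk unit_disk (m n)).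
  { intros n. split.
    - intros z Hz. unfold unit_disk in Hz. apply ex_derive_cdiff, cdiff_fold_map; [apply Hp|lra].
    - intros z Hz. unfold unit_disk in *. generalize (Hm n z Hz) (He n); lra. }
  assert (Hf : forall n, holomorphic_map unit_disk X (f n)).
  { intros n. split.
    - intros z Hz. apply ex_derive_cdiff, (cdiff_comp (mobius (p n)) (m n)).
      + apply ex_derive_cdiff, (Hmh n), Hz.
      + apply cdiff_mobius; [apply Hp|]. apply Rlt_le, (Hmh n), Hz.
    - intros z Hz. assert (Q := proj2 (Hmh n) z Hz). unfold unit_disk in *.
      apply (Hp n); [apply mobius_lt1; [apply Hp|exact Q]|].
      unfold f. rewrite mobius_involutive by (trivial; apply Hp). now apply Hm. }
  assert (Hinv : forall n z, Cmod z < 1 -> ifs m n (mobius (p (S n)) z) = ifs m n z).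
  { intros n z Hz. destruct n; simpl; unfold m; now rewrite fold_map_mobius by (trivial; apply Hp). }
  assert (Hifs : forall n z, Cmod z < 1 -> ifs f n z = mobius (p 0%nat) (ifs m n z)).
  { induction n; intros z Hz; [reflexivity|]. simpl.
    assert (Q := proj2 (Hmh (S n)) z Hz). unfold unit_disk in Q.
    rewrite IHn by (apply mobius_lt1; [apply Hp|exact Q]). unfold f. now rewrite Hinv. }
  destruct (ifs_near_id_converges m (3/100) Hmh (fun n z Hz => proj2 (Hm n z Hz))) as (F & HF1 & HF2 & HF3).
  { intros n z Hz. destruct (Hp (S n)) as (P1 & P2 & _).
    unfold m. replace (3/100 * (1/2) ^ n) with (3 * e n) by (unfold e; field).
    assert (e (S n) <= e n) by (unfold e; simpl; generalize (Pn n); lra).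
    apply fold_map_near_id; trivial; generalize (He n); lra. }
  destruct (HD f Hf (fun z => mobius (p 0%nat) (F z))) as [c Hc].
  - split.
    + intros z Hz. unfold unit_disk in Hz. assert (Q := HF2 z Hz).
      apply ex_derive_cdiff, (cdiff_comp (mobius (p 0%nat)) F); [now apply HF1|].
      apply cdiff_mobius; [apply Hp|lra].
    + exists (fun n => n). split; [lia|]. intros K HK HKd eps Heps.
      destruct (compact_in_disk K HK HKd) as (r & Hr & HKr).
      destruct (Hp O) as (P1 & _). assert (P2 : 0 < (1 - Cmod (p O)) ^ 2) by (apply pow_lt; lra).
      destruct (half_pow_small (2 * (3/100 / (1 - r) ^ 2) / (1 - Cmod (p O)) ^ 2) eps Heps) as [N HN].
      exists N. intros n Hn z Hz. specialize (HKr z Hz). specialize (HKd z Hz). unfold unit_disk in HKd.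
      rewrite Hifs by exact HKd.
      assert (Q := HF2 z HKd). assert (Q' := ifs_in unit_disk m (fun z H => H) Hmh n z HKd). unfold unit_disk in Q'.
      eapply Rle_lt_trans; [apply mobius_lipschitz; lra|].
      eapply Rle_lt_trans; [|exact HN].
      replace (2 * (3/100 / (1 - r) ^ 2) / (1 - Cmod (p O)) ^ 2 * (1/2) ^ N)
        with (2 * (3/100 / (1 - r) ^ 2) * (1/2) ^ N / (1 - Cmod (p O)) ^ 2) by (field; lra).
      apply Rmult_le_compat_r; [apply Rlt_le, Rinv_0_lt_compat; exact P2|].
      eapply Rle_trans; [now apply HF3|].
      apply Rmult_le_compat.
      * apply Rmult_le_pos; [lra|]. apply Rdiv_le_0_compat; [lra|apply pow_lt; lra].
      * apply pow_le; lra.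
      * apply Rmult_le_compat_l; [lra|]. apply Rmult_le_compat_l; [lra|].
        apply Rinv_le_contravar; [apply pow_lt; lra|]. apply pow_incr; lra.
      * replace n with (N + (n - N))%nat by lia. rewrite pow_add.
        generalize (Pn N) (Pn (n - N)%nat). intros. nra.
  - assert (H0 : unit_disk 0%C) by (unfold unit_disk; rewrite Cmod_0; lra).
    assert (Hh : Cmod (RtoC (1/2)) = 1/2) by (rewrite Cmod_R, Rabs_pos_eq; lra).
    assert (H12 : unit_disk (RtoC (1/2))) by (unfold unit_disk; rewrite Hh; lra).
    assert (E : F 0%C = F (RtoC (1/2))).
    { assert (Q0 := HF2 _ H0). assert (Q1 := HF2 _ H12). unfold unit_disk in *.
      rewrite <- (mobius_involutive (p O) (F 0%C)), <- (mobius_involutive (p O) (F (RtoC (1/2)))) by (try apply Hp; lra).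
      now rewrite (Hc 0%C H0), (Hc _ H12). }
    assert (E0 : F 0%C = 0%C).
    { apply Cmod_eq_0. generalize (HF2 _ H0) (Cmod_ge_0 (F 0%C)). rewrite Cmod_0. lra. }
    rewrite E0 in E.
    assert (A1 := HF3 O _ H12). rewrite <- E, Hh in A1. simpl ifs in A1.
    destruct (Hp 1%nat) as (P1 & P2 & _).
    assert (e 1%nat <= e O) by (unfold e; simpl; lra).
    assert (A2 : Cmod (m O (RtoC (1/2)) - RtoC (1/2))%C <= 3 * e O / (1 - Cmod (RtoC (1/2)))).
    { apply fold_map_near_id; trivial; try (generalize (He O); lra). }
    rewrite Hh in A2. unfold e in A2. simpl in A1, A2.
    replace (m O (RtoC (1/2)) - 0)%C with (m O (RtoC (1/2))) in A1 by ring.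
    generalize (Cmod_le_add_sub (RtoC (1/2)) (m O (RtoC (1/2)))). rewrite Hh, Cmod_sub_sym. lra.
Qed.

Theorem corollary1p1 (X : C -> Prop) (hX : subdomain X unit_disk) :
  rho_Bloch X <-> degenerate X.
Proof.
  split; [|apply degenerate_rho_Bloch].
  apply rho_Bloch_degenerate, hX.
Qed.
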